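(* Let $\mathscr{H}$ be a real Hilbert space and $-1\le q<1$. There is a unitary isomorphism (the $q$-Segal–Bargmann transform) $$\mathscr S_q\colon L^2(\Gamma_q(\mathscr H),\tau_q)\to L^2(\mathcal H_q(\mathscr H_{\mathbb C}),\tau_q)$$ which makes the diagram of isometries commute, i.e. $(\mathscr S_q A)\Omega=\delta_q(A\Omega)$ for all $A\in L^2(\Gamma_q(\mathscr H),\tau_q)$ (where $A\mapsto A\Omega$ denotes the $L^2$-extension of the map into Fock space). If $\{e_j\}$ are orthonormal vectors in $\mathscr H$ and $j_\ell\ne j_{\ell+1}$ for $1\le\ell\le k-1$, then $$\mathscr S_q\colon H^q_{n_1}(X_q(e_{j_1}))\cdots H^q_{n_k}(X_q(e_{j_k}))\mapsto Z_q(e_{j_1})^{n_1}\cdots Z_q(e_{j_k})^{n_k}.$$ Moreover $\mathscr S_q$ respects the number operators: $\mathscr S_qN_q=N_q\mathscr S_q$.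
   Context: Inner products are linear in the first and conjugate-linear in the second variable. $q$-Fock space. For a real Hilbert space $\mathscr{K}$ with complexification $\mathscr{K}_{\mathbb C}$, let $\Omega$ be a unit vector (the vacuum) spanning $\mathscr{K}_{\mathbb C}^{\otimes 0}=\mathbb C\Omega$, and let $\mathcal F(\mathscr K)=\bigoplus_{n\ge 0}\mathscr{K}_{\mathbb C}^{\otimes n}$ (algebraic sum and tensor products). Define the positive semidefinite Hermitian form by $(\Omega,\Omega)_q=1$ and $(f_1\otimes\cdots\otimes f_j,g_1\otimes\cdots\otimes g_k)_q=\delta_{jk}\sum_{\pi\in S_k}q^{\iota(\pi)}(f_1,g_{\pi 1})\cdots(f_k,g_{\pi k})$, where $\iota(\pi)$ is the number of inversions of $\pi$ and $0^0=1$. For $-1<q<1$ it is an inner product and $\mathcal F_q(\mathscr K)$ is the completion of $\mathcal F(\mathscr K)$; for $q=-1$ one first quotients by the kernel of the form and then completes (tensors then denote their classes). $q$-Gaussian algebra. For $f\in\mathscr K$, $c_q(f)$ is the bounded operator on $\mathcal F_q(\mathscr K)$ with $c_q(f)\Omega=f$, $c_q(f)f_1\otimes\cdots\otimes f_k=f\otimes f_1\otimes\cdots\otimes f_k$; $c_q^*(f)$ is its adjoint, and $X_q(f)=c_q(f)+c_q^*(f)$. $\Gamma_q(\mathscr K)$ is the von Neumann algebra generated by $\{X_q(f): f\in\mathscr K\}$. The state $\tau_q(A)=(A\Omega,\Omega)_q$ is a faithful normal tracial state on $\Gamma_q(\mathscr K)$. It is known that $A\mapsto A\Omega$ extends to a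 unitary $L^2(\Gamma_q(\mathscr K),\tau_q)\to\mathcal F_q(\mathscr K)$. $q$-Hermite polynomials: $H^q_0(x)=1$, $H^q_1(x)=x$, $xH^q_n(x)=H^q_{n+1}(x)+\frac{q^n-1}{q-1}H^q_{n-1}(x)$. Number operator. $N_q$ is the self-adjoint operator on $\mathcal F_q(\mathscr K)$ with $N_q\Omega=0$ and $N_q(f_1\otimes\cdots\otimes f_n)=n\,f_1\otimes\cdots\otimes f_n$; via the unitary $L^2(\Gamma_q(\mathscr K),\tau_q)\to\mathcal F_q(\mathscr K)$ extending $A\mapsto A\Omega$ it acts on $L^2(\Gamma_q(\mathscr K),\tau_q)$. Holomorphic algebra. With $\mathscr K=\mathscr H\oplus\mathscr H$, for $h\in\mathscr H$ put $Z_q(h)=\frac1{\sqrt2}(X_q(h,0)+iX_q(0,h))\in\Gamma_q(\mathscr H\oplus\mathscr H)$. $\mathcal H_q(\mathscr H_{\mathbb C})$ is the (unital, norm-closed) Banach algebra generated by $\{Z_q(h):h\in\mathscr H\}$, $L^2(\mathcal H_q(\mathscr H_{\mathbb C}),\tau_q)$ is its closure in $L^2(\Gamma_q(\mathscr H\oplus\mathscr H),\tau_q)$, and it carries the restriction of the number operator $N_q$ of $\Gamma_q(\mathscr H\oplus\mathscr H)$. Diagonal embedding. $\delta\colon\mathscr H_{\mathbb C}\to\mathscr H_{\mathbb C}\oplus\mathscr H_{\mathbb C}$, $\delta(h)=2^{-1/2}(h,ih)$, is isometric and induces the isometric embedding $\delta_q\colon\mathcal F_q(\mathscr H)\hookrightarrow\mathcal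 F_q(\mathscr H\oplus\mathscr H)$ with $\delta_q\Omega=\Omega$ and $\delta_q(h_1\otimes\cdots\otimes h_n)=\delta(h_1)\otimes\cdots\otimes\delta(h_n)$.
   Formalization: The product formula is proved with all n_l ≥ 1 and, besides j_l ≠ j_{l+1}, under the assumption that q = 0 or the j_l are pairwise distinct; as printed it fails for q ≠ 0, e.g. X(e_1)X(e_2)X(e_1)Ω = e_1⊗e_2⊗e_1 + q e_2. *)

(* Defs.v *)
From HB Require Import structures.
From mathcomp Require Import all_boot all_order all_algebra all_fingroup.
From mathcomp Require Import sesquilinear.
From mathcomp Require Import complex.
From mathcomp Require Import all_classical all_reals all_analysis.

Set Implicit Arguments.
Unset Strict Implicit.
Unset Printing Implicit Defensive.

Import Order.TTheory GRing.Theory Num.Theory.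
Import numFieldNormedType.Exports.

Local Open Scope classical_set_scope.
Local Open Scope ring_scope.
Local Open Scope complex_scope.

(* [theta] is [idfun] for real and [conjC] for complex Hilbert spaces.  Forms
   of type [{dot _ for theta}] are linear in the first variable and
   theta-linear in the second. *)
Record hilbert (K : numFieldType) (theta : K -> K) := Hilbert {
  hilbert_sort :> completeNormedModType K;
  inner : {dot hilbert_sort for theta};
  inner_norm : forall x : hilbert_sort, inner x x = `|x| ^+ 2 }.

Arguments inner {K theta} h.

Notation realHilbert R := (@hilbert R (@idfun R)).
Notation complexHilbert R := (@hilbert R[i] (@Num.conj R[i])).

(* The pair [(x, y)] stands for [x + i y]. *)
Definition complexification (R : realType) (K : lmodType R) : Type :=
  (K * K)%type.

Section Complexification.
Variables (R : realType) (K : lmodType R).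
Local Notation KC := (complexification K).

HB.instance Definition _ := GRing.Zmodule.copy KC (K * K)%type.

Definition cscale (a : R[i]) (u : KC) : KC :=
  (complex.Re a *: u.1 - complex.Im a *: u.2,
   complex.Re a *: u.2 + complex.Im a *: u.1).

Let cscaleA a b u : cscale a (cscale b u) = cscale (a * b) u.
Proof.
case: a b u => [ar ai] [br bi] [x y]; rewrite /cscale /=.
congr pair; rewrite !(scalerBr, scalerDr, scalerBl, scalerDl, scalerA).
  by rewrite !opprD [X in _ + X = _]addrC addrACA.
by rewrite [X in _ + X = _]addrC addrACA.
Qed.

Let cscale1 : left_id 1 cscale.
Proof. by case=> x y; rewrite /cscale /= !scale1r !scale0r subr0 addr0. Qed.

Let cscaleDr : right_distributive cscale +%R.
Proof.
move=> [ar ai] [x y] [x' y']; rewrite /cscale /=.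
congr pair; rewrite !scalerDr ?opprD /=; exact: addrACA.
Qed.

Let cscaleDl u : {morph cscale^~ u : a b / a + b}.
Proof.
move=> [ar ai] [br bi]; case: u => x y; rewrite /cscale /=.
congr pair; rewrite !scalerDl ?opprD /=; exact: addrACA.
Qed.

HB.instance Definition _ := GRing.Zmodule_isLmodule.Build R[i] KC
  cscaleA cscale1 cscaleDr cscaleDl.

Definition of_real (x : K) : KC := (x, 0).

(* Sesquilinear extension of [dot]: linear in the first variable,
   conjugate-linear in the second. *)
Definition cdot (dot : K -> K -> R) (u v : KC) : R[i] :=
  (dot u.1 v.1 + dot u.2 v.2) +i* (dot u.2 v.1 - dot u.1 v.2).

End Complexification.

Definition dot_sum (R : realType) (H : lmodType R) (dot : H -> H -> R)
    (u v : (H * H)%type) : R :=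
  dot u.1 v.1 + dot u.2 v.2.

(* The identification of [H_C (+) H_C] with [(H (+) H)_C]. *)
Definition cpair (R : realType) (H : lmodType R)
    (u v : complexification H) : complexification (H * H)%type :=
  ((u.1, v.1), (u.2, v.2)).

Definition diag (R : realType) (H : lmodType R) (h : complexification H) :
    complexification (H * H)%type :=
  ((Num.sqrt 2)^-1)%:C *: cpair h ('i *: h).

Definition bounded_op (R : realType) (V W : normedModType R[i]) (T : V -> W) :=
  linear T /\ exists M : R[i], forall x, `|T x| <= M * `|x|.

Definition isometric (R : realType) (V W : complexHilbert R) (T : V -> W) :=
  linear T /\ forall x y, inner W (T x) (T y) = inner V x y.

Definition unitary_onto (R : realType) (V W : complexHilbert R) (T : V -> W)
    (E : set W) :=
  isometric T /\ range T = E.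

Section Operators.
Variables (R : realType) (F : complexHilbert R).
Implicit Types (A B : F -> F) (M S : set (F -> F)).

Definition adjoint A : F -> F :=
  get [set B | bounded_op B /\ forall x y, inner F (A x) y = inner F x (B y)].

(* Sums and multiples of operators are those of the pointwise structure on
   [F -> F], products are compositions. *)
Definition op_prod k (T : nat -> F -> F) : F -> F :=
  \big[(fun A B => A \o B)/idfun]_(l < k) T l.

Definition op_horner (p : {poly R}) A : F -> F :=
  \sum_(i < size p) (p`_i)%:C *: iter i A.

Definition wot_adherent M A :=
  forall (s : seq (F * F)) (e : R), 0 < e -> exists2 B, M B &
    forall p, p \in s -> `|inner F (A p.1 - B p.1) p.2| < e%:C.

Definition norm_adherent M A :=
  forall e : R, 0 < e -> exists2 B, M B &
    forall x, `|A x - B x| <= e%:C * `|x|.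

Record unital_algebra M : Prop := UnitalAlgebra {
  alg_bounded : forall A, M A -> bounded_op A;
  alg_id : M idfun;
  alg_add : forall A B, M A -> M B -> M (A + B);
  alg_scale : forall (a : R[i]) A, M A -> M (a *: A);
  alg_comp : forall A B, M A -> M B -> M (A \o B) }.

Record von_neumann_algebra M : Prop := VonNeumannAlgebra {
  vN_alg : unital_algebra M;
  vN_adjoint : forall A, M A -> M (adjoint A);
  vN_closed : forall A, bounded_op A -> wot_adherent M A -> M A }.

Record banach_algebra M : Prop := BanachAlgebra {
  banach_alg : unital_algebra M;
  banach_closed : forall A, bounded_op A -> norm_adherent M A -> M A }.

Definition vN_generated S : set (F -> F) :=
  [set A | forall M, von_neumann_algebra M -> S `<=` M -> M A].

Definition banach_generated S : set (F -> F) :=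
  [set A | forall M, banach_algebra M -> S `<=` M -> M A].

(* Unbounded operators are given by their graphs; this says that [G] is densely
   defined and coincides with the graph of its Hilbert space adjoint. *)
Definition self_adjoint_graph (G : set (F * F)) :=
  closure (fst @` G) = setT /\
  forall x y, G (x, y) <->
    forall u v, G (u, v) -> inner F v x = inner F u y.

End Operators.

Definition inversions n (s : 'S_n) : nat :=
  #|[set p : 'I_n * 'I_n | (p.1 < p.2)%N && (s p.2 < s p.1)%N]|.

Section Words.
Variables (R : realType) (q : R) (K : lmodType R) (dot : K -> K -> R).
Local Notation KC := (complexification K).

(* The form of the q-Fock space on elementary tensors; the tensor
   [f_1 (x) ... (x) f_n] is encoded by the sequence [[:: f_1; ...; f_n]]. *)
Definition q_form (s t : seq KC) : R[i] :=
  if size s == size t then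
    \sum_(p : 'S_(size s)) (q ^+ inversions p)%:C *
      \prod_(i < size s) cdot dot (nth 0 s i) (nth 0 t (p i))
  else 0.

(* The separated completion of the algebraic Fock space for the form
   [q_form], characterized as a Hilbert space with a copy of the elementary
   tensors which has the prescribed Gram matrix and a dense linear span.
   Since [q_form] is multi-sesquilinear and the norm of the Hilbert space is
   definite, multilinearity of [tensor] is a consequence, and for q = -1 the
   kernel of the form is sent to 0.  All such spaces are isomorphic by a unique
   unitary preserving tensors. *)
Record q_Fock := QFock {
  fock_space :> complexHilbert R;
  tensor : seq KC -> fock_space;
  tensor_inner : forall s t,
    inner fock_space (tensor s) (tensor t) = q_form s t;
  tensor_dense :
    closure [set x | exists c : seq (R[i] * seq KC),
                       x = \sum_(p <- c) p.1 *: tensor p.2] = setT }.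

End Words.

Section QGaussian.
Variables (R : realType) (q : R) (K : lmodType R) (dot : K -> K -> R).
Variable F : q_Fock q dot.

Definition vacuum : F := tensor F [::].

(* Here and below, [get] selects the operator with the given properties, which
   is unique because the tensors span a dense subspace. *)
Definition creation (f : K) : F -> F :=
  get [set C : F -> F | bounded_op C /\
        forall w, C (tensor F w) = tensor F (of_real f :: w)].

Definition q_gaussian (f : K) : F -> F := creation f + adjoint (creation f).

Definition Gamma_q : set (F -> F) := vN_generated (range q_gaussian).

Definition tau_q (A : F -> F) : R[i] := inner F (A vacuum) vacuum.

(* Unique since the number operator on the span of the tensors is essentially
   self-adjoint. *)
Definition number_op : set (F * F) :=
  get [set G | self_adjoint_graph G /\
        forall w, G (tensor F w, (size w)%:R *: tensor F w)].

End QGaussian.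

Arguments vacuum {R q K dot} F.
Arguments creation {R q K dot} F f.
Arguments q_gaussian {R q K dot} F f.
Arguments Gamma_q {R q K dot} F.
Arguments tau_q {R q K dot} F A.
Arguments number_op {R q K dot} F.

(* The completion of an algebra [G] of operators for the inner product
   [(A, B) |-> tau (B^* A)], characterized as above. *)
Record L2_space (R : realType) (F : complexHilbert R) (G : set (F -> F))
    (tau : (F -> F) -> R[i]) := L2Space {
  L2_sort :> complexHilbert R;
  L2_class : (F -> F) -> L2_sort;
  L2_inner : forall A B, G A -> G B ->
    inner L2_sort (L2_class A) (L2_class B) = tau (adjoint B \o A);
  L2_dense : closure (L2_class @` G) = setT }.

Notation L2_Gamma F := (L2_space (Gamma_q F) (tau_q F)).

Section L2Gamma.
Variables (R : realType) (q : R) (K : lmodType R) (dot : K -> K -> R).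
Variables (F : q_Fock q dot) (L : L2_Gamma F).

(* The continuous extension of [A |-> A Omega]. *)
Definition at_vacuum : L -> F :=
  get [set U : L -> F | bounded_op U /\
        forall A, Gamma_q F A -> U (L2_class L A) = A (vacuum F)].

Definition number_L2 : set (L * L) :=
  [set p | number_op F (at_vacuum p.1, at_vacuum p.2)].

End L2Gamma.

Fixpoint q_hermite (R : realType) (q : R) (n : nat) : {poly R} :=
  match n with
  | 0 => 1
  | n1.+1 => match n1 with
    | 0 => 'X
    | n2.+1 => 'X * q_hermite q n1
               - ((q ^+ n1 - 1) / (q - 1))%:P * q_hermite q n2
    end
  end.

Section Holomorphic.
Variables (R : realType) (q : R) (H : lmodType R) (dot : H -> H -> R).
Variable FF : q_Fock q (dot_sum dot).

Definition Z_q (h : H) : FF -> FF :=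
  ((Num.sqrt 2)^-1)%:C *:
    (q_gaussian FF (h, 0) + 'i *: q_gaussian FF (0, h)).

Definition hol_alg : set (FF -> FF) := banach_generated (range Z_q).

Definition L2_hol (LL : L2_Gamma FF) : set LL :=
  closure (L2_class LL @` hol_alg).

Definition number_hol (LL : L2_Gamma FF) : set (LL * LL) :=
  [set p | number_L2 p /\ L2_hol p.1].

Definition diag_q (F : q_Fock q dot) : F -> FF :=
  get [set D : F -> FF | [/\ isometric D, D (vacuum F) = vacuum FF &
        forall w, D (tensor F w) = tensor FF (map (@diag R H) w)]].

End Holomorphic.

Arguments Z_q {R q H dot} FF h.
Arguments diag_q {R q H dot} FF F.
Arguments L2_hol {R q H dot FF} LL.
Arguments number_hol {R q H dot FF} LL.

(* Main.v *)
(* Riesz representation provides adjoints, so [A |-> A Omega] is isometric on the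
   L2 space, and it is onto since [X(f) T w = T (f :: w) + shorter words] makes
   the vacuum cyclic.  The transform is thus the diagonal embedding [delta_q]
   transported through these unitaries.  Its range is the holomorphic space
   because [Z_q h] acts on the range of [delta_q] as [delta_q] composed with the
   creation operator of [h]: its two annihilation parts cancel there.  The
   Hermite formula holds because both sides applied to the vacuum are elementary
   tensors, and the number operators correspond because [delta_q] intertwines
   the resolvents [(1 + N)^-1], while its adjoint shows that no vector outside
   the range of [delta_q] is reached. *)

Require Import Defs.
From HB Require Import structures.
From mathcomp Require Import all_boot all_order all_algebra all_fingroup.
From mathcomp Require Import sesquilinear complex.
From mathcomp Require Import all_classical all_reals all_analysis.
From mathcomp Require Import ring zify.

Set Implicit Arguments.
Unset Strict Implicit.
Unset Printing Implicit Defensive.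

Import Order.TTheory GRing.Theory Num.Theory.
Import numFieldNormedType.Exports.

Local Open Scope classical_set_scope.
Local Open Scope ring_scope.
Local Open Scope complex_scope.

(** * Hilbert spaces *)

(** The Fock space is known only through the Gram matrix of its tensors, and for [q = -1] the form
    is degenerate, so prescribing values on tensors need not define an operator. Maps are therefore
    built from formal linear combinations: a norm inequality between two combinations with the same
    coefficients yields a well-defined bounded map, which provides the existence behind [creation],
    [at_vacuum] and [diag_q]. For this reason adjointness and the q-commutation relation are proved
    for formal combinations before any operator is available.

    In the Hermite formula no Gaussian factor may contract with a letter to its right. A repeated
    index can break this even if its occurrences are not adjacent: [X(e1) X(e2) X(e1)] sends the
    vacuum to [e1 e2 e1 + q e2], while the product of the [Z] gives only the image of the first
    term. Hence the alternative between [q = 0] and pairwise distinct indices. For [q = 0] a factor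
    sees only the next letter, and positive exponents ensure that this letter belongs to the
    neighbouring block. *)

Section InnerProduct.
Variables (R : realType) (V : complexHilbert R).
Implicit Types (x y z : V) (a : R[i]).
Local Notation "<< x , y >>" := (inner V x y).

Lemma innerC x y : <<x, y>> = Num.conj <<y, x>>.
Proof. by rewrite (hermC (inner V)) expr0 mul1r. Qed.

Lemma innerDl z x y : <<x + y, z>> = <<x, z>> + <<y, z>>.
Proof. exact: linearDl. Qed.

Lemma innerZl z a x : <<a *: x, z>> = a * <<x, z>>.
Proof. exact: linearZl_LR. Qed.

Lemma innerDr z x y : <<z, x + y>> = <<z, x>> + <<z, y>>.
Proof. exact: linearDr. Qed.

Lemma innerZr z a x : <<z, a *: x>> = Num.conj a * <<z, x>>.
Proof. exact: linearZr_LR. Qed.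

Lemma innerBl z x y : <<x - y, z>> = <<x, z>> - <<y, z>>.
Proof. exact: linearBl. Qed.

Lemma innerBr z x y : <<z, x - y>> = <<z, x>> - <<z, y>>.
Proof. exact: linearBr. Qed.

Lemma inner0l z : <<0, z>> = 0.
Proof. exact: linear0l. Qed.

Lemma inner_suml I (r : seq I) (P : pred I) (E : I -> V) z :
  <<\sum_(i <- r | P i) E i, z>> = \sum_(i <- r | P i) <<E i, z>>.
Proof. exact: linear_sumlz. Qed.

Lemma inner_sumr I (r : seq I) (P : pred I) (E : I -> V) z :
  <<z, \sum_(i <- r | P i) E i>> = \sum_(i <- r | P i) <<z, E i>>.
Proof. exact: linear_sumr. Qed.

Lemma innerE x : <<x, x>> = `|x| ^+ 2.
Proof. exact: inner_norm. Qed.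

Lemma inner_inj x y : (forall z, <<x, z>> = <<y, z>>) -> x = y.
Proof.
move=> h; apply/eqP; rewrite -subr_eq0 -normr_eq0 -sqrf_eq0 -innerE.
by rewrite innerBl h subrr.
Qed.

Lemma sqr_normB x y :
  `|x - y| ^+ 2 = `|x| ^+ 2 + `|y| ^+ 2 - (<<x, y>> + <<y, x>>).
Proof. by rewrite -!innerE innerBl !innerBr; ring. Qed.

Lemma parallelogram x y :
  `|x - y| ^+ 2 + `|x + y| ^+ 2 = 2 * (`|x| ^+ 2 + `|y| ^+ 2).
Proof. by rewrite -!innerE innerBl innerDl !innerBr !innerDr; ring. Qed.

Lemma cauchy_schwarz x y : `|<<x, y>>| <= `|x| * `|y|.
Proof.
have [->|y0] := eqVneq y 0.
  by rewrite innerC inner0l rmorph0 !normr0 mulr0.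
have ny : 0 < `|y| by rewrite normr_gt0.
rewrite -(@ler_pXn2r _ 2%N) ?nnegrE // ?mulr_ge0 // exprMn.
pose a := <<x, y>> / `|y| ^+ 2.
have y20 : `|y| ^+ 2 != 0 by rewrite sqrf_eq0 normr_eq0.
have : 0 <= `|x - a *: y| ^+ 2 by rewrite exprn_ge0.
rewrite sqr_normB normrZ exprMn innerZr innerZl (innerC y x).
have -> : `|x| ^+ 2 + `|a| ^+ 2 * `|y| ^+ 2 -
  (Num.conj a * <<x, y>> + a * Num.conj <<x, y>>) =
  `|x| ^+ 2 - `|<<x, y>>| ^+ 2 / `|y| ^+ 2.
  have cy : Num.conj `|y| = `|y| by rewrite geC0_conj.
  rewrite /a normrM normfV [in LHS]exprMn !normrX normr_id.
  rewrite fmorph_div /= rmorphXn /= cy normCK; field.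
  by rewrite normr_eq0.
by rewrite subr_ge0 ler_pdivrMr // exprn_gt0.
Qed.

End InnerProduct.

(** * Estimates up to epsilon and completeness *)

Lemma eq0_le_eps (K : numFieldType) (V : normedZmodType K) (C : K) (x : V) :
  (forall e : K, 0 < e -> `|x| <= C * e) -> x = 0.
Proof.
move=> h; apply/eqP/negPn/negP => x0.
have nx : 0 < `|x| by rewrite normr_gt0.
have Cge : 0 <= C by have := h 1 ltr01; rewrite mulr1; apply: le_trans.
have C1 : 0 < C + 1 by rewrite ltr_wpDl.
have e0 : 0 < `|x| / (C + 1) by rewrite divr_gt0.
have /= := h _ e0; rewrite mulrCA ler_pMr // ler_pdivlMr // mul1r.
by rewrite gerDl ler10.
Qed.

(** The order of [R[i]] is only partial, so realness of [a] and [b] is what turns the failure of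
    [a <= b] into [b < a]; then [e = (a - b) / (2 * C)] is contradictory. *)
Lemma le_eps (K : numFieldType) (a b C : K) : 0 < C ->
  a \is Num.real -> b \is Num.real ->
  (forall e : K, 0 < e -> a <= b + C * e) -> a <= b.
Proof.
move=> C0 ar br h; case: (real_leP ar br) => // ba.
have ab : 0 < a - b by rewrite subr_gt0.
have C2 : 0 < 2 * C by rewrite mulr_gt0.
have := h _ (divr_gt0 ab C2).
have -> : C * ((a - b) / (2 * C)) = (a - b) / 2 by field; rewrite gt_eqF.
by rewrite -lerBlDl ler_pMr // invf_ge1 // (ler_nat _ 2 1).
Qed.

(** The sets form a filter base, and shrinking diameters make its filter Cauchy. This form of
    completeness replaces sequences in the extension by density, in the minimization behind [riesz]
    and in the closed range of an isometry. *)
Lemma nested_limit (K : numFieldType) (W : completeNormedModType K)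
    (A : K -> set W) :
  (forall e, 0 < e -> A e !=set0) ->
  (forall d e, 0 < d -> d <= e -> A d `<=` A e) ->
  (forall e, 0 < e -> exists2 d, 0 < d &
     forall x y, A d x -> A d y -> `|x - y| < e) ->
  exists l, forall e, 0 < e ->
    exists2 d, 0 < d & forall x, A d x -> `|x - l| < e.
Proof.
move=> A0 AS Ac.
pose G := filter_from [set e : K | 0 < e] A.
have GF : ProperFilter G.
  apply: filter_from_proper; last by move=> e; exact: A0.
  apply: filter_from_filter; first by exists 1 => /=.
  move=> d e /= d0 e0.
  case: (real_leP (gtr0_real d0) (gtr0_real e0)) => [de|/ltW ed].
    by exists d => // x Ax; split => //; exact: AS de _ Ax.
  by exists e => // x Ax; split => //; exact: AS ed _ Ax.
have cG : cauchy G.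
  apply: cauchy_exP => e e0; have [d d0 dA] := Ac e e0.
  have [x Ax] := A0 d d0; exists x; exists d => // y Ay.
  by rewrite -ball_normE /=; exact: dA.
have /cvg_ex[l Gl] : cvg G by exact: cauchy_cvg cG.
exists l => e e0; have : G (ball l e) by apply: Gl; exact: nbhsx_ballx.
by case=> d d0 dA; exists d => // x /dA; rewrite -ball_normE /= distrC.
Qed.

Lemma closureP (K : numFieldType) (V : normedModType K) (A : set V) (x : V) :
  closure A x <-> forall e : K, 0 < e -> exists2 y, A y & `|x - y| < e.
Proof.
split=> [h e e0|h B /nbhs_ballP[e /= e0 eB]].
  have [y [Ay]] := h _ (nbhsx_ballx x e e0).
  by rewrite -ball_normE /= => xy; exists y.
by have [y Ay xy] := h e e0; exists y; split => //; apply: eB; rewrite -ball_normE.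
Qed.

Lemma denseP (K : numFieldType) (V : normedModType K) (A : set V) :
  closure A = setT <->
  forall (x : V) (e : K), 0 < e -> exists2 y, A y & `|x - y| < e.
Proof.
split=> [h x|h]; first by apply/closureP; rewrite h.
by rewrite -subTset => x _; apply/closureP; exact: h.
Qed.

(** * Formal combinations and extension by density *)

Section LinearCombinations.
Variables (K : nzRingType) (V : lmodType K) (I : Type) (T : I -> V).
Implicit Type c : seq (K * I).

(** The coefficients stay a list, with no identification of equal vectors, so that one list can be
    evaluated in two spaces and the results compared. *)
Definition lincomb c : V := \sum_(p <- c) p.1 *: T p.2.

Lemma lincomb_cat c d : lincomb (c ++ d) = lincomb c + lincomb d.
Proof. exact: big_cat. Qed.

Definition scale_comb (a : K) c := [seq (a * p.1, p.2) | p <- c].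

Lemma lincombZ a c : lincomb (scale_comb a c) = a *: lincomb c.
Proof.
rewrite /lincomb big_map scaler_sumr.
by apply: eq_bigr => p _; rewrite scalerA.
Qed.

Lemma lincomb1 i : lincomb [:: (1, i)] = T i.
Proof. by rewrite /lincomb big_seq1 scale1r. Qed.

End LinearCombinations.

Lemma lincomb_linear (K : nzRingType) (V W : lmodType K) (I : Type)
    (T : I -> V) (D : V -> W) c :
  linear D -> D (lincomb T c) = lincomb (D \o T) c.
Proof.
move=> lD; pose D' := HB.pack D (GRing.isLinear.Build _ _ _ _ D lD) : {linear V -> W}.
rewrite -[D]/(D' : _ -> _) /lincomb linear_sum.
by apply: eq_bigr => p _; rewrite linearZ.
Qed.

Section Bounded.
Variables (R : realType) (V W : normedModType R[i]).

Lemma linear_op0 (D : V -> W) : linear D -> D 0 = 0.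
Proof. by move=> lD; have := lD (-1) 0 0; rewrite scaler0 addr0 scaleN1r addNr. Qed.

Lemma linear_opD (D : V -> W) x y : linear D -> D (x + y) = D x + D y.
Proof. by move=> lD; have := lD 1 x y; rewrite !scale1r. Qed.

Lemma linear_opZ (D : V -> W) a x : linear D -> D (a *: x) = a *: D x.
Proof. by move=> lD; have := lD a x 0; rewrite (linear_op0 lD) !addr0. Qed.

Lemma linear_opB (D : V -> W) x y : linear D -> D (x - y) = D x - D y.
Proof.
by move=> lD; rewrite linear_opD // -scaleN1r linear_opZ // scaleN1r.
Qed.

(** The constant in [bounded_op] is an arbitrary complex number, unconstrained on the zero space.
    Since [M * |x|] is nonnegative it equals [|M| * |x|], so [|M| + 1] is a positive bound. *)
Lemma bounded_opP (D : V -> W) : bounded_op D ->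
  exists2 M : R[i], 0 < M & forall x, `|D x| <= M * `|x|.
Proof.
case=> _ [M DM]; exists (`|M| + 1); first by rewrite ltr_pwDr.
move=> x; rewrite mulrDl mul1r ler_wpDr //.
have Mx : 0 <= M * `|x| by apply: le_trans (DM x).
by rewrite -[`|x| in leRHS]normr_id -normrM ger0_norm // .
Qed.

End Bounded.

Section Density.
Variables (R : realType) (V W : normedModType R[i]).

Lemma eq_bounded_dense (D E : V -> W) (A : set V) :
  bounded_op D -> bounded_op E -> closure A = setT ->
  (forall x, A x -> D x = E x) -> D = E.
Proof.
move=> bD bE /denseP dA DE; apply/funext => x; apply/eqP; rewrite -subr_eq0.
have [M M0 DM] := bounded_opP bD; have [N N0 EN] := bounded_opP bE.
apply/eqP; apply: (@eq0_le_eps _ _ (M + N)) => e e0.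
have [y Ay xy] := dA x e e0.
have -> : D x - E x = D (x - y) - E (x - y).
  by rewrite (linear_opB _ _ bD.1) (linear_opB _ _ bE.1) (DE y) // opprB addrA subrK.
apply: le_trans (ler_normB _ _) _; rewrite mulrDl lerD //.
  by apply: le_trans (DM _) _; rewrite ler_pM2l // ltW.
by apply: le_trans (EN _) _; rewrite ler_pM2l // ltW.
Qed.

Lemma eq_bounded_lincomb I (T : I -> V) (D E : V -> W) :
  bounded_op D -> bounded_op E -> closure (range (lincomb T)) = setT ->
  (forall i, D (T i) = E (T i)) -> D = E.
Proof.
move=> bD bE dT DE; apply: (eq_bounded_dense bD bE dT) => _ [c _ <-].
rewrite (lincomb_linear _ _ bD.1) (lincomb_linear _ _ bE.1).
by congr (lincomb _ c); apply/funext => i; exact: DE.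
Qed.

End Density.

(** [D] is the closure [Ext] of the relation between [lincomb T c] and [lincomb T' c]: the
    inequality makes it single-valued, completeness of [W] and density make it total. *)
Lemma bounded_extension (R : realType) (V : normedModType R[i])
    (W : completeNormedModType R[i]) I (T : I -> V) (T' : I -> W) (M : R[i]) :
  closure (range (lincomb T)) = setT ->
  (forall c, `|lincomb T' c| <= M * `|lincomb T c|) ->
  exists D : V -> W,
    [/\ linear D, forall x, `|D x| <= M * `|x| & forall i, D (T i) = T' i].
Proof.
move=> /denseP dT TM.
(* A nonzero combination forces [0 <= M]. If [M = 0], or if all combinations vanish, every [T' i] is
   zero and the zero map works. *)
wlog M0 : / 0 < M.
  case: (pselect (exists c, lincomb T c != 0)) => [[c c0]|nT] H.
    have c1 : 0 < `|lincomb T c| by rewrite normr_gt0.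
    have : 0 <= M by rewrite -(pmulr_lge0 _ c1) (le_trans _ (TM c)).
    rewrite le_eqVlt => /orP[/eqP M0|]; last exact: H.
    exists (fun=> 0); split=> [a x y||i]; rewrite ?scaler0 ?addr0 //.
      by move=> x; rewrite -M0 mul0r normr0.
    have := TM [:: (1, i)]; rewrite -M0 mul0r normr_le0 lincomb1.
    by move/eqP.
  have T0 c : lincomb T c = 0.
    by apply: contra_notP nT => /eqP; exists c.
  have V0 (x : V) : x = 0.
    apply: (@eq0_le_eps _ _ 1) => e e0; have [y [c _ <-]] := dT x e e0.
    by rewrite T0 subr0 mul1r => /ltW.
  exists (fun=> 0); split=> [a x y||i]; rewrite ?scaler0 ?addr0 //.
    by move=> x; rewrite (V0 x) !normr0 mulr0.
  have := TM [:: (1, i)]; rewrite T0 normr0 mulr0 normr_le0 lincomb1.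
  by move/eqP.
pose A x (e : R[i]) := [set lincomb T' c | c in [set c | `|x - lincomb T c| < e]].
pose Ext x y := forall e, 0 < e -> exists2 c,
  `|x - lincomb T c| < e & `|y - lincomb T' c| < e.
have Tlip c d : `|lincomb T' c - lincomb T' d| <=
    M * `|lincomb T c - lincomb T d|.
  by have := TM (c ++ scale_comb (-1) d); rewrite !lincomb_cat !lincombZ !scaleN1r.
have exE x : exists y, Ext x y.
  have [|||l Al] := @nested_limit _ W (A x).
  - by move=> e /(dT x)[_ [c _ <-] xc]; exists (lincomb T' c), c.
  - by move=> d e _ de _ [c /= xc <-]; exists c => //=; exact: lt_le_trans de.
  - move=> e e0; have M2 : 0 < M * 2 by rewrite mulr_gt0.
    exists (e / (M * 2)); first by rewrite divr_gt0.
    move=> _ _ [c /= xc <-] [d /= xd <-].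
    apply: le_lt_trans (Tlip c d) _.
    rewrite -ltr_pdivlMl //; apply: le_lt_trans (ler_distD x _ _) _.
    rewrite (distrC _ x); apply: lt_le_trans (ltrD xc xd) _.
    by rewrite le_eqVlt; apply/orP; left; apply/eqP; field; rewrite gt_eqF.
  - exists l => e e0; have [d d0 dl] := Al e e0.
    have [m [m0 md me]] : exists m, [/\ 0 < m, m <= d & m <= e].
      by case: (real_leP (gtr0_real d0) (gtr0_real e0)) => [|/ltW];
        [exists d|exists e].
    have [_ [c _ <-] xc] := dT x m m0; exists c; first exact: lt_le_trans me.
    by rewrite distrC; apply: dl; exists c => //=; exact: lt_le_trans md.
have Ext_lip x y x' y' : Ext x y -> Ext x' y' -> `|y - y'| <= M * `|x - x'|.
  move=> h h'; apply: (@le_eps _ _ _ (2 + M * 2)).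
  - by rewrite ltr_pwDl // mulr_ge0 // ltW.
  - exact: normr_real.
  - by rewrite realM ?normr_real ?gtr0_real.
  move=> e e0; have [c xc yc] := h e e0; have [d xd yd] := h' e e0.
  apply: le_trans (ler_distD (lincomb T' c) _ _) _.
  apply: le_trans (lerD (lexx _) (ler_distD (lincomb T' d) _ _)) _.
  have cd := Tlip c d; rewrite (distrC _ y').
  have cd2 : `|lincomb T c - lincomb T d| <= e + (`|x - x'| + e).
    apply: le_trans (ler_distD x _ _) _; rewrite distrC; apply: lerD (ltW xc) _.
    apply: le_trans (ler_distD x' _ _) _.
    by apply: lerD (lexx _) (ltW xd).
  have cd3 := le_trans cd (ler_wpM2l (ltW M0) cd2).
  apply: le_trans (lerD (ltW yc) (lerD cd3 (ltW yd))) _.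
  by rewrite le_eqVlt; apply/orP; left; apply/eqP; ring.
have Ext_eq x y y' : Ext x y -> Ext x y' -> y = y'.
  move=> h h'; apply/eqP; rewrite -subr_eq0 -normr_le0.
  by have := Ext_lip _ _ _ _ h h'; rewrite subrr normr0 mulr0.
have Ext_T c : Ext (lincomb T c) (lincomb T' c).
  by move=> e e0; exists c; rewrite subrr normr0.
have Ext_lin a x y x' y' : Ext x y -> Ext x' y' -> Ext (a *: x + x') (a *: y + y').
  move=> h h' e e0; have a1 : 0 < `|a| + 1 by rewrite ltr_pwDr.
  have d0 : 0 < e / (`|a| + 1) by rewrite divr_gt0.
  have [c xc yc] := h _ d0; have [d xd yd] := h' _ d0.
  have est (U : normedModType R[i]) (u v u' v' : U) :
      `|u - v| < e / (`|a| + 1) -> `|u' - v'| < e / (`|a| + 1) ->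
      `|a *: u + u' - (a *: v + v')| < e.
    move=> uv uv'; rewrite opprD addrACA -scalerBr.
    apply: le_lt_trans (ler_normD _ _) _; rewrite normrZ.
    have -> : e = `|a| * (e / (`|a| + 1)) + e / (`|a| + 1).
      by field; rewrite gt_eqF.
    by apply: ler_ltD => //; rewrite ler_wpM2l // ltW.
  by exists (scale_comb a c ++ d); rewrite lincomb_cat lincombZ; exact: est.
have [D DE] := choice exE.
exists D; split=> [a x y|x|i].
- exact: Ext_eq (DE _) (Ext_lin _ _ _ _ _ (DE x) (DE y)).
- have h0 : Ext 0 0 by have := Ext_T [::]; rewrite /lincomb !big_nil.
  by have := Ext_lip _ _ _ _ (DE x) h0; rewrite !subr0.
- by have := Ext_T [:: (1, i)]; rewrite !lincomb1; exact: Ext_eq.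
Qed.

(** * Isometries and Gram matrices *)

Lemma isometricP (R : realType) (V W : complexHilbert R) (D : V -> W) :
  isometric D -> forall x, `|D x| = `|x|.
Proof.
move=> [_ Di] x; apply/eqP; rewrite -(eqrXn2 (n := 2%N)) //.
by rewrite -!innerE Di.
Qed.

Lemma isometric_bounded (R : realType) (V W : complexHilbert R) (D : V -> W) :
  isometric D -> bounded_op D.
Proof.
by move=> Di; split; [exact: Di.1|exists 1 => x; rewrite isometricP // mul1r].
Qed.

Lemma isometric_inj (R : realType) (V W : complexHilbert R) (D : V -> W) :
  isometric D -> injective D.
Proof.
move=> Di x y Dxy; apply/eqP; rewrite -subr_eq0 -normr_eq0 -(isometricP Di).
by rewrite (linear_opB _ _ Di.1) Dxy subrr normr0.
Qed.

Section Gram.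
Variables (R : realType) (V W : complexHilbert R) (I : Type).
Variables (T : I -> V) (T' : I -> W).

Lemma gram_lincomb c d :
  (forall i j, inner W (T' i) (T' j) = inner V (T i) (T j)) ->
  inner W (lincomb T' c) (lincomb T' d) = inner V (lincomb T c) (lincomb T d).
Proof.
move=> g; rewrite /lincomb !inner_suml; apply: eq_bigr => p _.
rewrite !inner_sumr; apply: eq_bigr => r _.
by rewrite !innerZl !innerZr g.
Qed.

Lemma isometric_extension :
  closure (range (lincomb T)) = setT ->
  (forall i j, inner W (T' i) (T' j) = inner V (T i) (T j)) ->
  exists D : V -> W, isometric D /\ forall i, D (T i) = T' i.
Proof.
move=> dT g.
have gn c : `|lincomb T' c| <= 1 * `|lincomb T c|.
  rewrite mul1r le_eqVlt; apply/orP; left; rewrite -(eqrXn2 (n := 2%N)) //.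
  by rewrite -!innerE gram_lincomb.
have [D [lD bD DT]] := bounded_extension dT gn.
exists D; split => //; split => // x y.
have Di : {in range (lincomb T) &, forall x y, inner W (D x) (D y) = inner V x y}.
  move=> _ _ /set_mem[c _ <-] /set_mem[d _ <-].
  rewrite !(lincomb_linear _ _ lD).
  have -> : D \o T = T' by apply/funext => i; exact: DT.
  exact: gram_lincomb.
have D1 u : `|D u| <= `|u| by rewrite -[leRHS]mul1r.
apply/eqP; rewrite -subr_eq0; apply/eqP.
apply: (@eq0_le_eps _ _ (2 * (`|x| + `|y| + 1))) => e e0.
have [m [m0 me m1]] : exists m : R[i], [/\ 0 < m, m <= e & m <= 1].
  by case: (real_leP (gtr0_real e0) (real1 R[i])) => [|/ltW]; [exists e|exists 1].
move/denseP: dT => dT.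
have [u Tu xu] := dT x m m0; have [v Tv yv] := dT y m m0.
(* The inner products agree at the approximants [u] and [v]. Each remaining bracket is at most
   [(|x| + |y| + 1) * e], where [m <= 1] gives [|u| <= |x| + 1]. *)
have -> : inner W (D x) (D y) - inner V x y =
   (inner W (D (x - u)) (D y) + inner W (D u) (D (y - v)))
   - (inner V (x - u) y + inner V u (y - v)).
  rewrite !(linear_opB _ _ lD) !innerBl !innerBr (Di u v) ?inE //; ring.
have nu : `|u| <= `|x| + 1.
  rewrite -[u in leLHS](subrK x) addrC; apply: le_trans (ler_normD _ _) _.
  by rewrite lerD2l distrC (le_trans (ltW xu)).
apply: le_trans (ler_normB _ _) _; rewrite mulr2n mulrDl mulrDl mul1r.
have e1 (U : complexHilbert R) (a b c d : U) : `|a| <= m -> `|b| <= `|y| ->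
    `|c| <= `|x| + 1 -> `|d| <= m ->
    `|inner U a b + inner U c d| <= (`|x| + `|y| + 1) * e.
  move=> ha hb hc hd; apply: le_trans (ler_normD _ _) _.
  apply: le_trans (lerD (cauchy_schwarz _ _) (cauchy_schwarz _ _)) _.
  have := lerD (ler_pM (normr_ge0 _) (normr_ge0 _) ha hb)
    (ler_pM (normr_ge0 _) (normr_ge0 _) hc hd).
  move=> /le_trans; apply.
  rewrite mulrC -mulrDl [`|y| + _]addrCA addrA.
  by rewrite ler_pM ?addr_ge0 // ltW.
by rewrite lerD //; apply: e1 => //; rewrite ?(le_trans (D1 _)) // 1?ltW.
Qed.

End Gram.
(** * Riesz representation and adjoints *)

Lemma Re_le_norm (R : realType) (z : R[i]) : z + Num.conj z <= 2 * `|z|.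
Proof.
have -> : z + Num.conj z = 2 * (complex.Re z)%:C by rewrite -addcJ.
rewrite ler_pM2l //; apply: le_trans (normc_ge_Re z).
by rewrite lecR ler_norm.
Qed.

Section Riesz.
Variables (R : realType) (V : complexHilbert R) (l : V -> R[i]) (M : R[i]).
Hypothesis l_lin : forall a x y, l (a *: x + y) = a * l x + l y.
Hypothesis l_bnd : forall x, `|l x| <= M * `|x|.

(* Minimizing [psi x = |x - z|^2 - |z|^2] yields the representing vector [z]. *)
Let psi x : R[i] := `|x| ^+ 2 - (l x + Num.conj (l x)).

Let psi_real x : psi x = (complex.Re (psi x))%:C.
Proof.
rewrite RRe_real // realB // ?realX ?normr_real //.
rewrite -[_ + _]/(_ + (l x)^*%C) addcJ realM // ?realn //.
by apply/complex_realP; exists (complex.Re (l x)).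
Qed.

Let psi_lb x : - (`|M| ^+ 2) <= psi x.
Proof.
rewrite /psi lerBrDl.
have h : l x + Num.conj (l x) <= 2 * (`|M| * `|x|).
  apply: le_trans (Re_le_norm _) _; rewrite ler_pM2l //.
  have Mx : 0 <= M * `|x| by apply: le_trans (l_bnd x).
  by rewrite -[`|x|]normr_id -normrM ger0_norm.
apply: le_trans (lerD h (lexx _)) _.
rewrite lerBlDr -subr_ge0.
have -> : `|x| ^+ 2 + `|M| ^+ 2 - 2 * (`|M| * `|x|) = (`|x| - `|M|) ^+ 2 by ring.
by rewrite real_exprn_even_ge0 // realB // normr_real.
Qed.

Let m : R[i] := (inf (range (fun x => complex.Re (psi x))))%:C.

Let hinf : has_inf (range (fun x => complex.Re (psi x))).
Proof.
split; first by exists (complex.Re (psi 0)), 0.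
exists (complex.Re (- (`|M| ^+ 2))) => _ [x _ <-] /=.
by have := psi_lb x; rewrite lecE => /andP[].
Qed.

Let psi_ge x : m <= psi x.
Proof. by rewrite psi_real /m lecR; apply: ge_inf; [exact: hinf.2|exists x]. Qed.

Let psi_near (e : R[i]) : 0 < e -> exists x, psi x < m + e.
Proof.
move=> e0; have er : (complex.Re e)%:C = e by rewrite RRe_real // gtr0_real.
have e0' : 0 < complex.Re e by rewrite -ltcR er.
have [_ [x _ <-] /= hx] := inf_adherent e0' hinf.
by exists x; rewrite -er psi_real -rmorphD /= ltcR.
Qed.

(** The part of [psi] given by [l] cancels in the parallelogram law. As the midpoint stays above the
    infimum, near-minimizers are close to each other. *)
Let psi_mid x y :
  `|x - y| ^+ 2 = 2 * psi x + 2 * psi y - 4 * psi (2^-1 *: (x + y)).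
Proof.
have := parallelogram x y => /(canRL (addrK _)) ->.
have -> : psi (2^-1 *: (x + y)) =
    `|x + y| ^+ 2 / 4 - 2^-1 * (l x + l y + Num.conj (l x + l y)).
  rewrite /psi normrZ exprMn ger0_norm ?invr_ge0 //.
  have lE : l (2^-1 *: (x + y)) = 2^-1 * (l x + l y).
    have l0 : l 0 = 0 by have := l_lin (-1) 0 0; rewrite scaler0 addr0 mulN1r addNr.
    have := l_lin 2^-1 (x + y) 0; rewrite addr0 l0 addr0 => ->.
    by have := l_lin 1 x y; rewrite scale1r mul1r => ->.
  rewrite lE rmorphM /= fmorphV /= rmorph_nat; by field.
by rewrite /psi rmorphD /=; field.
Qed.

Let psi_shift s x y : psi (x + s *: y) = psi x + `|s| ^+ 2 * `|y| ^+ 2 -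
  (s * (l y - inner V y x) + Num.conj (s * (l y - inner V y x))).
Proof.
rewrite /psi (addrC x) l_lin.
rewrite -!innerE innerDl !innerDr !innerZl !innerZr normCK (innerC x y).
rewrite !rmorphD /= !rmorphM /= rmorphB /=; ring.
Qed.

(** An approximate Euler equation: the optimal step [s = conj w / |y|^2] along [y] lowers [psi] by
    [|w|^2 / |y|^2], yet [psi] cannot fall below [m]. *)
Let near_min (e : R[i]) x y : 0 < e -> psi x < m + e ->
  `|l y - inner V y x| ^+ 2 <= e * `|y| ^+ 2.
Proof.
move=> e0 hx; have [->|y0] := eqVneq y 0.
  have l0 : l 0 = 0 by have := l_lin (-1) 0 0; rewrite scaler0 addr0 mulN1r addNr.
  by rewrite l0 inner0l subrr !normr0 expr0n mulr0.
have ny : 0 < `|y| ^+ 2 by rewrite exprn_gt0 // normr_gt0.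
set w := l y - _; rewrite -ler_pdivrMr //.
have := psi_ge (x + (Num.conj w / `|y| ^+ 2) *: y); rewrite psi_shift -/w.
have cy : Num.conj `|y| = `|y| by rewrite geC0_conj.
have -> : psi x + `|Num.conj w / `|y| ^+ 2| ^+ 2 * `|y| ^+ 2 -
   (Num.conj w / `|y| ^+ 2 * w + Num.conj (Num.conj w / `|y| ^+ 2 * w)) =
   psi x - `|w| ^+ 2 / `|y| ^+ 2.
  rewrite rmorphM /= fmorph_div /= rmorphXn /= cy conjCK.
  rewrite normrM normfV norm_conjC normrX normr_id exprMn !normCK; field.
  by rewrite normr_eq0.
rewrite lerBrDl => h; rewrite -(lerD2l m) addrC; apply: le_trans (ltW hx).
by rewrite addrC addrC.
Qed.

Lemma riesz : exists z, forall x, l x = inner V x z.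
Proof.
have [|||z zA] := @nested_limit _ V (fun e => [set x | psi x < m + e]).
- by move=> e /psi_near[x]; exists x.
- by move=> d e _ de x /= h; apply: lt_le_trans h _; rewrite lerD2l.
(* With this level [psi_mid] bounds [|x - y|^2] by [4 * (m + e^2 / 4) - 4 * m = e^2]. *)
- move=> e e0; exists (e ^+ 2 / 4); first by rewrite divr_gt0 // exprn_gt0.
  move=> x y /= hx hy; rewrite -(@ltr_pXn2r _ 2%N) ?nnegrE // ?ltW //.
  rewrite psi_mid.
  have h1 : 2 * psi x < 2 * (m + e ^+ 2 / 4) by rewrite ltr_pM2l.
  have h2 : 2 * psi y < 2 * (m + e ^+ 2 / 4) by rewrite ltr_pM2l.
  have h3 : - (4 * psi (2^-1 *: (x + y))) <= - (4 * m).
    by rewrite lerN2 ler_pM2l.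
  apply: lt_le_trans (ltr_leD (ltrD h1 h2) h3) _.
  by rewrite le_eqVlt; apply/orP; left; apply/eqP; field.
exists z => y; apply/eqP; rewrite -subr_eq0; apply/eqP.
apply: (@eq0_le_eps _ _ (2 * `|y|)) => e e0.
have [d d0 dz] := zA e e0.
have [c [c0 cd ce]] : exists c : R[i], [/\ 0 < c, c <= d & c <= e ^+ 2].
  have e20 : 0 < e ^+ 2 by rewrite exprn_gt0.
  by case: (real_leP (gtr0_real d0) (gtr0_real e20)) => [|/ltW];
    [exists d|exists (e ^+ 2)].
have [x hx] := psi_near c0.
have xz : `|x - z| < e by apply: dz => /=; apply: lt_le_trans hx _; rewrite lerD2l.
have lx : `|l y - inner V y x| <= `|y| * e.
  rewrite -(@ler_pXn2r _ 2%N) ?nnegrE // ?mulr_ge0 ?(ltW e0) //.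
  apply: le_trans (near_min y c0 hx) _.
  by rewrite exprMn mulrC ler_wpM2l // exprn_ge0.
have -> : l y - inner V y z = (l y - inner V y x) + inner V y (x - z).
  by rewrite innerBr; ring.
apply: le_trans (ler_normD _ _) _.
have -> : 2 * `|y| * e = `|y| * e + `|y| * e by ring.
rewrite lerD //; apply: le_trans (cauchy_schwarz _ _) _.
by rewrite ler_wpM2l // ltW.
Qed.

End Riesz.

(** [riesz] is applied to [x |-> <D x, y>], and the bound on [E] comes from
    [|E y|^2 = <D (E y), y>]. Two different spaces are allowed because the number operator argument
    uses the adjoint of [diag_q]. *)
Lemma adjoint_exists (R : realType) (V W : complexHilbert R) (D : V -> W) :
  bounded_op D ->
  exists E : W -> V, bounded_op E /\ forall x y, inner W (D x) y = inner V x (E y).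
Proof.
move=> bD; have [M M0 DM] := bounded_opP bD; have lD := bD.1.
have /choice[E DE] (y : W) : exists z, forall x, inner W (D x) y = inner V x z.
  apply: (@riesz _ _ (fun x => inner W (D x) y) (M * `|y|)) => [a u v|x].
    by rewrite lD innerDl innerZl.
  apply: le_trans (cauchy_schwarz _ _) _.
  by apply: le_trans (ler_wpM2r _ (DM x)) _ => //; rewrite mulrAC.
exists E; split; last by move=> x y; exact: DE.
split.
  move=> a x y; apply: inner_inj => z.
  rewrite innerC -DE innerDr innerZr rmorphD rmorphM /= conjCK.
  by rewrite innerDl innerZl (innerC (E x)) (innerC (E y)) -!DE.
exists M => y; have [->|E0] := eqVneq (E y) 0.
  by rewrite normr0 mulr_ge0 // ltW.
have nE : 0 < `|E y| by rewrite normr_gt0.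
rewrite -(ler_pM2l nE) -expr2 -innerE -DE.
apply: le_trans (_ : _ <= `|inner W (D (E y)) y|) _.
  by rewrite real_ler_norm // DE innerE realX // normr_real.
apply: le_trans (cauchy_schwarz _ _) _.
by rewrite mulrCA mulrA ler_wpM2r // DM.
Qed.

Section Adjoint.
Variables (R : realType) (F : complexHilbert R).
Implicit Types A B : F -> F.

Lemma adjointP A : bounded_op A -> bounded_op (adjoint A) /\
  forall x y, inner F (A x) y = inner F x (adjoint A y).
Proof.
move=> /adjoint_exists[E hE].
exact: (getPex (ex_intro [set B | bounded_op B /\
  forall x y, inner F (A x) y = inner F x (B y)] E hE)).
Qed.

Lemma adjoint_bounded A : bounded_op A -> bounded_op (adjoint A).
Proof. by case/adjointP. Qed.

Lemma inner_adjointr A x y : bounded_op A ->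
  inner F x (adjoint A y) = inner F (A x) y.
Proof. by case/adjointP => _ ->. Qed.

Lemma inner_adjointl A x y : bounded_op A ->
  inner F (adjoint A x) y = inner F x (A y).
Proof. by move=> bA; rewrite innerC inner_adjointr // -innerC. Qed.

End Adjoint.
(** * Expansion of the q-form along the first letter *)

Lemma sum_ltn_ord n i : (i <= n)%N -> (\sum_(c < n) (c < i) = i)%N.
Proof.
move=> le_in; suff -> : (\sum_(c < n) (c < i) = minn i n)%N by apply/minn_idPl.
elim: n {le_in} => [|n IH]; first by rewrite big_ord0 minn0.
by rewrite big_ord_recr /= IH; lia.
Qed.

Lemma inversionsE n (s : 'S_n) :
  inversions s = (\sum_(a < n) \sum_(b < n) ((a < b) && (s b < s a)))%N.
Proof.
rewrite /inversions -sum1_card big_mkcond pair_bigA /=.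
apply: eq_bigr => -[a b] _; case: ifPn => [/set_mem /= -> //|/negP h].
by case E: (_ && _) => //; case: h; exact: mem_set.
Qed.

(** Position 0 precedes all others and its value [i] exceeds exactly [i] of the other values;
    lifting preserves the order among the rest. Reindexing by [s^-1] turns the count over positions
    into one over values. *)
Lemma inversions_lift_perm n (i : 'I_n.+1) (s : 'S_n) :
  inversions (lift_perm ord0 i s) = (i + inversions s)%N.
Proof.
rewrite !inversionsE big_ord_recl; congr addn.
  rewrite big_ord_recl ltnn /= add0n lift_perm_id.
  under eq_bigr => b _ do rewrite lift_perm_lift.
  rewrite (reindex_inj (perm_inj (s := s^-1%g))) /=.
  transitivity (\sum_(c < n) (c < i))%N; last by apply: sum_ltn_ord; rewrite -ltnS.
  by apply: eq_bigr => c _; rewrite permKV /= /bump; congr nat_of_bool; lia.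
apply: eq_bigr => a _; rewrite big_ord_recl /= add0n.
apply: eq_bigr => b _; rewrite !lift_perm_lift /=.
by rewrite /bump !add1n ltnS; congr (nat_of_bool (_ && _)); lia.
Qed.

Lemma lift_perm_bij n :
  bijective (fun x : 'I_n.+1 * 'S_n => lift_perm ord0 x.1 x.2).
Proof.
apply: inj_card_bij; last by rewrite card_prod !card_Sn card_ord factS.
move=> [i s] [j t] /= e.
have ij : i = j by rewrite -(lift_perm_id ord0 i s) e lift_perm_id.
rewrite -ij in e *; congr pair; apply/permP => k.
apply: (@lift_inj _ i).
by rewrite -(lift_perm_lift ord0 i s) e lift_perm_lift.
Qed.

Definition del_nth (T : Type) i (s : seq T) := take i s ++ drop i.+1 s.

Lemma size_del_nth (T : Type) i (s : seq T) :
  (i < size s)%N -> size (del_nth i s) = (size s).-1.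
Proof. by move=> h; rewrite size_cat size_take size_drop h; lia. Qed.

(** The shift is [bump], the map underlying [lift], so deleting a letter matches [lift_perm] in the
    expansion of the form. *)
Lemma nth_del_nth (T : Type) (x0 : T) i (s : seq T) j :
  (i < size s)%N -> nth x0 (del_nth i s) j = nth x0 s (bump i j).
Proof.
move=> h; rewrite nth_cat size_take h /bump; case: ltnP => ij.
  by rewrite nth_take // add0n.
by rewrite nth_drop; congr nth; lia.
Qed.

Lemma del_nthS (T : Type) i x (s : seq T) :
  del_nth i.+1 (x :: s) = x :: del_nth i s.
Proof. by []. Qed.

Lemma map_del_nth (T U : Type) (f : T -> U) i (s : seq T) :
  map f (del_nth i s) = del_nth i (map f s).
Proof. by rewrite /del_nth map_cat map_take map_drop. Qed.

(** This covers [inner H] and [dot_sum] alike, without a Hilbert structure on [H * H]. Positivity is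
    read off from the norm of the Fock space in [dot_ge0]. *)
Record symmetric_bilinear (R : realType) (K : lmodType R) (dot : K -> K -> R) :
  Prop := SymmetricBilinear {
  dotDl : forall x y z, dot (x + y) z = dot x z + dot y z;
  dotZl : forall a x z, dot (a *: x) z = a * dot x z;
  dotC : forall x y, dot x y = dot y x }.

Section Cdot.
Variables (R : realType) (K : lmodType R) (dot : K -> K -> R).
Hypothesis hdot : symmetric_bilinear dot.
Local Notation KC := (complexification K).
Implicit Types u v w : KC.

Lemma cdotDl u v w : cdot dot (u + v) w = cdot dot u w + cdot dot v w.
Proof.
rewrite /cdot /= !(dotDl hdot); apply/eqP; rewrite eq_complex /=.
by apply/andP; split; apply/eqP; ring.
Qed.

Lemma cdotZl a u w : cdot dot (a *: u) w = a * cdot dot u w.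
Proof.
have dN x y : dot (- x) y = - dot x y by rewrite -scaleN1r (dotZl hdot) mulN1r.
case: a => ar ai; rewrite /cdot /= !(dotDl hdot) ?dN !(dotZl hdot).
apply/eqP; rewrite eq_complex /=.
by apply/andP; split; apply/eqP; ring.
Qed.

Lemma cdotC u v : cdot dot u v = Num.conj (cdot dot v u).
Proof.
apply/eqP; rewrite eq_complex /= !(dotC hdot u.1) !(dotC hdot u.2).
by apply/andP; split; apply/eqP; ring.
Qed.

Lemma cdot_real x y : cdot dot (of_real x) (of_real y) = (dot x y)%:C.
Proof.
have d0 z : dot 0 z = 0 by rewrite -(scale0r 0) (dotZl hdot) mul0r.
rewrite /cdot /of_real /= (dotC hdot x 0) !d0.
by rewrite addr0 subr0.
Qed.

End Cdot.

Section Qform.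
Variables (R : realType) (q : R) (K : lmodType R) (dot : K -> K -> R).
Local Notation KC := (complexification K).
Implicit Types s t w : seq KC.

Let qsum n (a b : nat -> KC) : R[i] :=
  \sum_(p : 'S_n) (q ^+ inversions p)%:C * \prod_(i < n) cdot dot (a i) (b (p i)).

Let qsum_rec n a b : qsum n.+1 a b =
  \sum_(i < n.+1) (q ^+ i)%:C *
    (cdot dot (a 0%N) (b i) * qsum n (a \o succn) (b \o bump i)).
Proof.
rewrite /qsum (reindex _ (onW_bij _ (lift_perm_bij n))) /=.
rewrite -(pair_bigA _ (fun i (s : 'S_n) => (q ^+ inversions (lift_perm ord0 i s))%:C *
   \prod_(j < n.+1) cdot dot (a j) (b (lift_perm ord0 i s j)))) /=.
apply: eq_bigr => i _; rewrite !mulr_sumr; apply: eq_bigr => s _.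
rewrite inversions_lift_perm exprD rmorphM /= big_ord_recl lift_perm_id /=.
under eq_bigr => j _ do rewrite lift_perm_lift.
rewrite /bump /=; under eq_bigr => j _ do rewrite add1n.
by ring.
Qed.

Let q_formE s t : size s = size t ->
  q_form q dot s t = qsum (size s) (nth 0 s) (nth 0 t).
Proof. by rewrite /q_form => ->; rewrite eqxx. Qed.

Lemma q_form_size s t : size s != size t -> q_form q dot s t = 0.
Proof. by rewrite /q_form => /negbTE ->. Qed.

Lemma q_form_nil : q_form q dot [::] [::] = 1.
Proof.
rewrite q_formE // /qsum /= (bigD1 1%g) //= big_ord0 mulr1.
rewrite big1 => [|p]; last by case/negP; apply/eqP/permP => -[].
rewrite addr0; suff -> : inversions (1%g : 'S_0) = 0%N by [].
by rewrite inversionsE big_ord0.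
Qed.

(** Permutations are sorted by the image [i] of the first position, which accounts for [i]
    inversions. This Laplace-type expansion replaces sums over permutations from here on, and its
    terms become those of [annihilate]. *)
Lemma q_form_cons u w t : q_form q dot (u :: w) t =
  \sum_(i < size t) (q ^+ i)%:C *
    (cdot dot u (nth 0 t i) * q_form q dot w (del_nth i t)).
Proof.
have [e|ne] := eqVneq (size (u :: w)) (size t); last first.
  rewrite q_form_size // big1 // => i _.
  rewrite q_form_size ?mulr0 // size_del_nth //.
  by apply: contra_neq ne => /= ->; rewrite prednK //; case: i => j; case: (size t).
move: e => /= e; rewrite q_formE //= qsum_rec e; apply: eq_bigr => i _.
have si : (i < size t)%N by [].
rewrite q_formE ?size_del_nth -?e //; congr (_ * (_ * _)).
apply: eq_bigr => p _; congr (_ * _); apply: eq_bigr => j _.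
by rewrite nth_del_nth.
Qed.

End Qform.
(** * Creation and annihilation operators *)

Lemma inner_dense_inj (R : realType) (V : complexHilbert R) (A : set V) (x y : V) :
  closure A = setT -> (forall z, A z -> inner V x z = inner V y z) -> x = y.
Proof.
move=> /denseP dA h; apply/eqP; rewrite -subr_eq0; apply/eqP.
have [//|xy0] := eqVneq (x - y) 0.
have nxy : 0 < `|x - y| by rewrite normr_gt0.
apply: (@eq0_le_eps _ _ 1) => e e0; have [z Az xyz] := dA (x - y) e e0.
rewrite mul1r -(ler_pM2l nxy) -expr2 -innerE.
have -> : inner V (x - y) (x - y) = inner V (x - y) (x - y - z).
  by rewrite [RHS]innerBr (innerBl z) (h z Az) subrr subr0.
apply: le_trans (_ : _ <= `|inner V (x - y) (x - y - z)|) _.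
  have -> : inner V (x - y) (x - y - z) = `|x - y| ^+ 2.
    by rewrite innerBr (innerBl z) (h z Az) subrr subr0 innerE.
  by rewrite normrX normr_id.
apply: le_trans (cauchy_schwarz _ _) _.
by rewrite ler_wpM2l // ltW.
Qed.

Lemma inner_lincomb_inj (R : realType) (V : complexHilbert R) I (T : I -> V)
    (x y : V) :
  closure (range (lincomb T)) = setT ->
  (forall i, inner V x (T i) = inner V y (T i)) -> x = y.
Proof.
move=> dT h; apply: (inner_dense_inj dT) => _ [c _ <-].
rewrite /lincomb !inner_sumr; apply: eq_bigr => p _.
by rewrite !innerZr h.
Qed.

Lemma conj_real (R : realType) (x : R) : Num.conj x%:C = x%:C.
Proof. exact: conjc_real. Qed.

Section Fock.
Variables (R : realType) (q : R) (K : lmodType R) (dot : K -> K -> R).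
Hypothesis hq : -1 <= q < 1.
Hypothesis hdot : symmetric_bilinear dot.
Variable F : q_Fock q dot.
Local Notation KC := (complexification K).
Local Notation T := (tensor F).
Implicit Types (u v : KC) (w t : seq KC) (f : K) (c d : seq (R[i] * seq KC)).

Lemma tensor_span_dense : closure (range (lincomb T)) = setT.
Proof.
rewrite -(tensor_dense F); congr closure; apply/seteqP; split=> x.
  by case=> c _ <-; exists c.
by case=> c ->; exists c.
Qed.

Lemma fock_inj (x y : F) :
  (forall t, inner F x (T t) = inner F y (T t)) -> x = y.
Proof. exact: inner_lincomb_inj tensor_span_dense. Qed.

Lemma eq_bounded_tensor (W : normedModType R[i]) (D E : F -> W) :
  bounded_op D -> bounded_op E -> (forall t, D (T t) = E (T t)) -> D = E.
Proof. by move=> bD bE; apply: eq_bounded_lincomb tensor_span_dense. Qed.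

Lemma tensor_inner_cons u w t : inner F (T (u :: w)) (T t) =
  \sum_(i < size t) (q ^+ i)%:C *
    (cdot dot u (nth 0 t i) * inner F (T w) (T (del_nth i t))).
Proof.
rewrite tensor_inner q_form_cons.
by apply: eq_bigr => i _; rewrite tensor_inner.
Qed.

(** Pairings with tensors separate vectors, and [q_form_cons] is linear in the head. Linearity in
    the head suffices because words are built from the front. *)
Lemma tensor_consD u v w : T (u + v :: w) = T (u :: w) + T (v :: w).
Proof.
apply: fock_inj => t; rewrite innerDl !tensor_inner_cons -big_split.
by apply: eq_bigr => i _; rewrite (cdotDl hdot) /=; ring.
Qed.

Lemma tensor_consZ a u w : T (a *: u :: w) = a *: T (u :: w).
Proof.
apply: fock_inj => t; rewrite innerZl !tensor_inner_cons mulr_sumr.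
by apply: eq_bigr => i _; rewrite (cdotZl hdot) /=; ring.
Qed.

(* Formal combinations representing the action of the creation and annihilation
   operators on elementary tensors. *)
Definition creation_comb f c := [seq (p.1, of_real f :: p.2) | p <- c].

Definition annihilation_word f w :=
  [seq ((q ^+ i)%:C * cdot dot (nth 0 w i) (of_real f), del_nth i w)
  | i <- index_iota 0 (size w)].

Definition annihilation_comb f c :=
  flatten [seq scale_comb p.1 (annihilation_word f p.2) | p <- c].

Definition annihilate f w : F := lincomb T (annihilation_word f w).

Lemma annihilateE f w : annihilate f w =
  \sum_(i < size w)
    ((q ^+ i)%:C * cdot dot (nth 0 w i) (of_real f)) *: T (del_nth i w).
Proof. by rewrite /annihilate /lincomb big_map big_mkord. Qed.

Lemma lincomb_creation f c :
  lincomb T (creation_comb f c) = lincomb (fun w => T (of_real f :: w)) c.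
Proof. by rewrite /lincomb big_map. Qed.

Lemma lincomb_annihilation f c :
  lincomb T (annihilation_comb f c) = lincomb (annihilate f) c.
Proof.
rewrite /annihilation_comb; elim: c => [|p c IH] /=.
  by rewrite /lincomb !big_nil.
by rewrite lincomb_cat IH lincombZ [RHS]/lincomb big_cons.
Qed.

Lemma inner_tensor_cons f w t :
  inner F (T (of_real f :: w)) (T t) = inner F (T w) (annihilate f t).
Proof.
rewrite tensor_inner_cons annihilateE inner_sumr; apply: eq_bigr => i _.
by rewrite innerZr rmorphM /= -(cdotC hdot) conj_real mulrA.
Qed.

(** Adjointness for representatives: it enters the norm estimate from which the operators are
    constructed. *)
Lemma inner_creation_comb f c d :
  inner F (lincomb T (creation_comb f c)) (lincomb T d) =
  inner F (lincomb T c) (lincomb T (annihilation_comb f d)).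
Proof.
rewrite lincomb_creation lincomb_annihilation /lincomb !inner_suml.
apply: eq_bigr => p _; rewrite !inner_sumr; apply: eq_bigr => r _.
by rewrite !innerZl !innerZr inner_tensor_cons.
Qed.

(** Deleting a letter behind [u] costs one extra factor [q] for passing [u]. *)
Lemma annihilate_cons f u w : annihilate f (u :: w) =
  cdot dot u (of_real f) *: T w +
  q%:C *: lincomb (fun t => T (u :: t)) (annihilation_word f w).
Proof.
rewrite annihilateE -[size (u :: w)]/(size w).+1 big_ord_recl expr0 mul1r.
congr (_ + _); first by rewrite /del_nth /= drop0.
rewrite /lincomb big_map big_mkord scaler_sumr; apply: eq_bigr => i _ /=.
by rewrite /bump leq0n add1n del_nthS exprS rmorphM /= scalerA mulrA.
Qed.

Lemma annihilation_creation f c :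
  lincomb T (annihilation_comb f (creation_comb f c)) =
  (dot f f)%:C *: lincomb T c +
  q%:C *: lincomb T (creation_comb f (annihilation_comb f c)).
Proof.
rewrite lincomb_annihilation lincomb_creation.
rewrite /creation_comb /annihilation_comb; elim: c => [|p c IH] /=.
  by rewrite /lincomb !big_nil !scaler0 addr0.
rewrite lincomb_cat lincombZ /lincomb !big_cons.
move: IH; rewrite /lincomb => ->.
rewrite annihilate_cons /lincomb (cdot_real hdot) /=.
rewrite !scalerDr !scalerA !(mulrC p.1) addrACA.
by congr (_ + _ + (_ + _)); rewrite ?scalerA ?(mulrC p.1).
Qed.

Lemma dot_ge0 f : 0 <= dot f f.
Proof.
have : 0 <= inner F (T [:: of_real f]) (T [:: of_real f]).
  by rewrite innerE exprn_ge0.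
rewrite tensor_inner_cons big_ord_recl big_ord0 /= expr0 mul1r addr0.
by rewrite /del_nth /= tensor_inner q_form_nil mulr1 (cdot_real hdot) lecR.
Qed.

Lemma sqr_norm_creation f c :
  `|lincomb T (creation_comb f c)| ^+ 2 = (dot f f)%:C * `|lincomb T c| ^+ 2 +
    q%:C * `|lincomb T (annihilation_comb f c)| ^+ 2.
Proof.
rewrite -!innerE inner_creation_comb annihilation_creation.
rewrite innerDr !innerZr !conj_real; congr (_ + _ * _).
by rewrite innerC inner_creation_comb -innerC.
Qed.

Lemma size_annihilation n f c : all (fun p => (size p.2 < n.+1)%N) c ->
  all (fun p => (size p.2 < n)%N) (annihilation_comb f c).
Proof.
rewrite /annihilation_comb; elim: c => //= p c IH /andP[pn /IH cn].
rewrite all_cat cn andbT /scale_comb /annihilation_word !all_map.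
apply/allP => i; rewrite mem_index_iota /= => iw; rewrite size_del_nth //.
by case: (size p.2) iw pn.
Qed.

(* Since [c^* c = |f|^2 + q c c^*], for [q >= 0] a bound [M] for [c] on words
   shorter than [n] bounds [c^*] on words of length at most [n], and
   [|f|^2 + q M^2 = M^2] when [M^2 = |f|^2 / (1 - q)]. *)
Lemma creation_bound f : exists2 M : R, 0 <= M & forall c,
  `|lincomb T (creation_comb f c)| <= M%:C * `|lincomb T c|.
Proof.
have le_sqr (M : R) (x y : F) : 0 <= M -> `|x| ^+ 2 <= (M ^+ 2)%:C * `|y| ^+ 2 ->
    `|x| <= M%:C * `|y|.
  move=> M0 h; rewrite -(@ler_pXn2r _ 2%N) ?nnegrE ?mulr_ge0 ?ler0c //.
  by rewrite exprMn -rmorphXn.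
(* For [q <= 0] the second term of [sqr_norm_creation] is nonpositive, so the norm of [f] is a bound
   at once, including at [q = -1]. *)
have [q0|/ltW q0] := lerP q 0.
  exists (Num.sqrt (dot f f)) => [|c]; first exact: sqrtr_ge0.
  apply: le_sqr; first exact: sqrtr_ge0.
  rewrite sqr_sqrtr ?dot_ge0 // sqr_norm_creation gerDl.
  by rewrite mulr_le0_ge0 ?exprn_ge0 // -[0]/(0%:C) lecR.
have q1 : 0 < 1 - q by rewrite subr_gt0; case/andP: hq.
pose M := Num.sqrt (dot f f / (1 - q)).
have M0 : 0 <= M by exact: sqrtr_ge0.
have M2 : M ^+ 2 = dot f f + q * M ^+ 2.
  rewrite /M sqr_sqrtr; first by field; rewrite gt_eqF.
  by rewrite divr_ge0 ?dot_ge0 ?ltW.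
exists M => // c.
have [n] : exists n, all (fun p => (size p.2 < n)%N) c.
  exists (\sum_(p <- c) size p.2).+1; apply/allP => p pc.
  by rewrite ltnS (big_rem p) //= leq_addr.
elim: n c => [|n IH] c.
  case: c => [_|p c /andP[]//].
  by rewrite /lincomb !big_nil !normr0 mulr0.
move=> cn; have an := IH _ (size_annihilation f cn).
have bn : `|lincomb T (annihilation_comb f c)| <= M%:C * `|lincomb T c|.
  set a := lincomb T (annihilation_comb f c) in an *.
  have [->|a0] := eqVneq a 0; first by rewrite normr0 mulr_ge0 ?ler0c.
  have na : 0 < `|a| by rewrite normr_gt0.
  rewrite -(ler_pM2l na) -expr2 -innerE /a -inner_creation_comb.
  apply: le_trans (_ : _ <=
    `|inner F (lincomb T (creation_comb f (annihilation_comb f c)))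
              (lincomb T c)|) _.
    by rewrite inner_creation_comb innerE normrX normr_id.
  apply: le_trans (cauchy_schwarz _ _) _; rewrite mulrA ler_wpM2r //.
  by rewrite mulrC.
apply: le_sqr => //; rewrite sqr_norm_creation M2 rmorphD /= mulrDl lerD2l.
rewrite rmorphM /= -mulrA ler_wpM2l ?ler0c // rmorphXn /= -exprMn.
by rewrite ler_pXn2r ?nnegrE ?mulr_ge0 ?ler0c.
Qed.

Lemma creationP f : bounded_op (creation F f) /\
  forall w, creation F f (T w) = T (of_real f :: w).
Proof.
have [M M0 hM] := creation_bound f.
have hM' c : `|lincomb (fun w => T (of_real f :: w)) c| <= M%:C * `|lincomb T c|.
  by rewrite -lincomb_creation.
have [D [lD bD DT]] := bounded_extension tensor_span_dense hM'.
have /getPex : exists C, [set C : F -> F | bounded_op C /\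
    forall w, C (T w) = T (of_real f :: w)] C.
  by exists D; split => //; split => //; exists M%:C.
by [].
Qed.

Lemma creation_bounded f : bounded_op (creation F f).
Proof. exact: (creationP f).1. Qed.

Lemma creationE f w : creation F f (T w) = T (of_real f :: w).
Proof. exact: (creationP f).2. Qed.

Lemma adjoint_creationE f w : adjoint (creation F f) (T w) = annihilate f w.
Proof.
apply: fock_inj => t; rewrite inner_adjointl ?creationE; last exact: creation_bounded.
by rewrite innerC inner_tensor_cons -innerC.
Qed.

Lemma q_gaussianE f w : q_gaussian F f (T w) = T (of_real f :: w) + annihilate f w.
Proof.
rewrite -[LHS]/(creation F f (T w) + adjoint (creation F f) (T w)).
by rewrite creationE adjoint_creationE.
Qed.

End Fock.
(** * Operator algebras and the vacuum vector *)

Section BoundedOperators.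
Variables (R : realType) (U V W : normedModType R[i]).

Lemma bounded_op_id : bounded_op (@idfun V).
Proof. by split => //; exists 1 => x; rewrite mul1r. Qed.

Lemma bounded_opD (A B : V -> W) : bounded_op A -> bounded_op B -> bounded_op (A + B).
Proof.
move=> bA bB; have [M M0 AM] := bounded_opP bA; have [N N0 BN] := bounded_opP bB.
split=> [a x y|].
  by rewrite !fctE bA.1 bB.1 scalerDr addrACA.
exists (M + N) => x; rewrite fctE mulrDl.
by apply: le_trans (ler_normD _ _) _; rewrite lerD.
Qed.

Lemma bounded_opZ a (A : V -> W) : bounded_op A -> bounded_op (a *: A).
Proof.
move=> bA; have [M M0 AM] := bounded_opP bA; split=> [b x y|].
  by rewrite !fctE bA.1 scalerDr !scalerA mulrC.
by exists (`|a| * M) => x; rewrite fctE normrZ -mulrA ler_wpM2l.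
Qed.

Lemma bounded_op_comp (A : V -> W) (B : U -> V) :
  bounded_op A -> bounded_op B -> bounded_op (A \o B).
Proof.
move=> bA bB; have [M M0 AM] := bounded_opP bA; have [N N0 BN] := bounded_opP bB.
split=> [a x y|]; first by rewrite /= bB.1 bA.1.
exists (M * N) => x; apply: le_trans (AM _) _.
by rewrite -mulrA ler_wpM2l // ltW.
Qed.

End BoundedOperators.

Section OperatorAlgebras.
Variables (R : realType) (F : complexHilbert R).
Implicit Types (A B : F -> F) (M S : set (F -> F)).

Lemma bounded_unital_algebra : unital_algebra (@bounded_op R F F).
Proof.
split=> //; [exact: bounded_op_id|exact: bounded_opD|exact: bounded_opZ|].
exact: bounded_op_comp.
Qed.

Lemma bounded_von_neumann : von_neumann_algebra (@bounded_op R F F).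
Proof. by split=> //; [exact: bounded_unital_algebra|exact: adjoint_bounded]. Qed.

(** An intersection inherits the closure properties; its members are bounded because the algebra of
    all bounded operators takes part in it. *)
Lemma vN_generated_von_neumann S : S `<=` @bounded_op R F F ->
  von_neumann_algebra (vN_generated S).
Proof.
move=> Sb; split.
- split.
  + by move=> A; apply => //; exact: bounded_von_neumann.
  + by move=> M vM _; exact: alg_id (vN_alg vM).
  + by move=> A B hA hB M vM SM; apply: (alg_add (vN_alg vM)); [exact: hA|exact: hB].
  + by move=> a A hA M vM SM; apply: (alg_scale (vN_alg vM)); exact: hA.
  + by move=> A B hA hB M vM SM; apply: (alg_comp (vN_alg vM)); [exact: hA|exact: hB].
- by move=> A hA M vM SM; apply: (vN_adjoint vM); exact: hA.
- move=> A bA wA M vM SM; apply: (vN_closed vM) => // s e e0.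
  by have [B hB sB] := wA s e e0; exists B => //; exact: hB.
Qed.

Lemma norm_wot_adherent M A : norm_adherent M A -> wot_adherent M A.
Proof.
move=> nA s e e0.
(* [C] dominates the product of norms for every pair at once, so one approximant within
   [e / (C + 1)] serves the whole list. *)
pose C : R := \sum_(p <- s) complex.Re (`|p.1| * `|p.2|).
have normE (p : F * F) : (complex.Re (`|p.1| * `|p.2|))%:C = `|p.1| * `|p.2|.
  by rewrite RRe_real // realM // normr_real.
have Re0 (p : F * F) : 0 <= complex.Re (`|p.1| * `|p.2|).
  by rewrite -ler0c normE mulr_ge0.
have C0 : 0 <= C by exact: sumr_ge0.
have C1 : 0 < C + 1 by rewrite ltr_wpDl.
have [B MB AB] := nA (e / (C + 1)) (divr_gt0 e0 C1).
exists B => // p ps.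
apply: le_lt_trans (cauchy_schwarz _ _) _.
apply: le_lt_trans (ler_wpM2r (normr_ge0 _) (AB p.1)) _.
rewrite -mulrA -normE -rmorphM /= ltcR mulrAC ltr_pdivrMr // ltr_pM2l //.
apply: le_lt_trans (_ : _ <= C) _; last by rewrite ltrDl.
by rewrite /C (big_rem p) //= lerDl sumr_ge0.
Qed.

Lemma von_neumann_banach M : von_neumann_algebra M -> banach_algebra M.
Proof.
move=> vM; split; first exact: vN_alg.
by move=> A bA /norm_wot_adherent; exact: vN_closed.
Qed.

Lemma unital_iter M A n : unital_algebra M -> M A -> M (iter n A).
Proof.
move=> uM MA; elim: n => [|n IH]; first exact: alg_id.
exact: (alg_comp uM MA IH).
Qed.

Lemma unital_prod M (T : nat -> F -> F) k : unital_algebra M ->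
  (forall l, (l < k)%N -> M (T l)) -> M (op_prod k T).
Proof.
move=> uM MT; rewrite /op_prod; apply: big_ind => [|A B|i _].
- exact: alg_id.
- exact: alg_comp.
- exact: MT.
Qed.

Lemma unital0 M : unital_algebra M -> M 0.
Proof.
move=> uM; rewrite -(scale0r (idfun : F -> F)).
by apply: alg_scale => //; exact: alg_id.
Qed.

Lemma unital_sum M I (r : seq I) (T : I -> F -> F) : unital_algebra M ->
  (forall i, M (T i)) -> M (\sum_(i <- r) T i).
Proof.
move=> uM MT; apply: big_ind => //; [exact: unital0|exact: alg_add].
Qed.

Lemma unital_horner M (p : {poly R}) A : unital_algebra M -> M A -> M (op_horner p A).
Proof.
move=> uM MA; apply: unital_sum => // i.
by apply: alg_scale => //; exact: unital_iter.
Qed.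

(** For [E] the range of [diag_q] this reduces invariance under the whole holomorphic algebra to
    invariance under the generators. *)
Lemma invariant_banach (E : set F) :
  (forall a x y, E x -> E y -> E (a *: x + y)) -> closure E `<=` E ->
  banach_algebra [set A | bounded_op A /\ forall x, E x -> E (A x)].
Proof.
move=> El Ec; split; first split.
- by move=> A [].
- by split=> //; exact: bounded_op_id.
- move=> A B [bA EA] [bB EB]; split; first exact: bounded_opD.
  move=> x Ex; rewrite fctE -[A x]scale1r; apply: (El); [exact: EA|exact: EB].
- move=> a A [bA EA]; split; first exact: bounded_opZ.
  move=> x Ex; rewrite fctE -[_ *: _]addr0; apply: (El); first exact: EA.
  by rewrite -(addNr x) -scaleN1r; apply: (El).
- move=> A B [bA EA] [bB EB]; split; first exact: bounded_op_comp.
  by move=> x Ex /=; apply: EA; exact: EB.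
- move=> A bA nA; split => // x Ex; apply: Ec; apply/closureP => e e0.
  have er : (complex.Re e)%:C = e by rewrite RRe_real // gtr0_real.
  have nx : (complex.Re `|x|)%:C = `|x| by rewrite RRe_real // normr_real.
  have nx0 : 0 <= complex.Re `|x| by rewrite -ler0c nx.
  have x1 : 0 < complex.Re `|x| + 1 by rewrite ltr_wpDl.
  have e0' : 0 < complex.Re e by rewrite -ltcR er.
  have [B [bB EB] AB] := nA _ (divr_gt0 e0' x1).
  exists (B x); first exact: EB.
  apply: le_lt_trans (AB x) _; rewrite -er -[X in _ * X]nx -rmorphM /= ltcR.
  by rewrite mulrAC ltr_pdivrMr // ltr_pM2l // ltrDl.
Qed.

End OperatorAlgebras.

(** Preimages of small balls around a limit point have small diameter, hence converge. *)
Lemma isometric_range_closed (R : realType) (V W : complexHilbert R) (D : V -> W) :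
  isometric D -> closure (range D) `<=` range D.
Proof.
move=> iD y /closureP yD.
have [|||l lA] := @nested_limit _ V (fun e => [set x | `|y - D x| < e]).
- by move=> e /yD[_ [x _ <-] xy]; exists x.
- by move=> d e _ de x /= h; exact: lt_le_trans de.
- move=> e e0; exists (e / 2) => [|u v /= hu hv]; first by rewrite divr_gt0.
  rewrite -(isometricP iD) (linear_opB _ _ iD.1) (splitr e).
  apply: le_lt_trans (ler_distD y _ _) _.
  by rewrite (distrC _ y) ltrD.
exists l => //; apply/eqP; rewrite -subr_eq0; apply/eqP.
apply: (@eq0_le_eps _ _ 2) => e e0; have [d d0 dl] := lA e e0.
have [m [m0 md me]] : exists m : R[i], [/\ 0 < m, m <= d & m <= e].
  by case: (real_leP (gtr0_real d0) (gtr0_real e0)) => [|/ltW];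
    [exists d|exists e].
have [_ [x _ <-] xy] := yD m m0.
apply: le_trans (ler_distD (D x) _ _) _.
rewrite -(linear_opB _ _ iD.1) (isometricP iD) mulrDl mul1r lerD //.
  by rewrite distrC ltW // dl //=; exact: lt_le_trans md.
by rewrite distrC ltW //; exact: lt_le_trans me.
Qed.

(** * Cyclicity of the vacuum and the map to Fock space *)

Section Vacuum.
Variables (R : realType) (q : R) (K : lmodType R) (dot : K -> K -> R).
Hypothesis hq : -1 <= q < 1.
Hypothesis hdot : symmetric_bilinear dot.
Variable F : q_Fock q dot.
Local Notation KC := (complexification K).
Local Notation T := (tensor F).
Implicit Types (u v : KC) (w t : seq KC) (f : K) (c d : seq (R[i] * seq KC)).

Lemma q_gaussian_bounded f : bounded_op (q_gaussian F f).
Proof.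
have bc := creation_bounded hq hdot F f.
by apply: bounded_opD => //; exact: adjoint_bounded.
Qed.

Lemma Gamma_von_neumann : von_neumann_algebra (Gamma_q F).
Proof. by apply: vN_generated_von_neumann => _ [f _ <-]; exact: q_gaussian_bounded. Qed.

Lemma Gamma_unital : unital_algebra (Gamma_q F).
Proof. exact: vN_alg Gamma_von_neumann. Qed.

Lemma Gamma_bounded A : Gamma_q F A -> bounded_op A.
Proof. by move=> GA; exact: (alg_bounded Gamma_unital GA). Qed.

Lemma Gamma_gaussian f : Gamma_q F (q_gaussian F f).
Proof. by move=> M vM; apply; exists f. Qed.

Lemma complexificationE u : u = of_real u.1 + 'i *: of_real u.2.
Proof.
case: u => x y; rewrite /of_real; congr pair; rewrite /= scale0r.
  by rewrite scaler0 subr0 addr0.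
by rewrite scale1r !add0r.
Qed.

Lemma tensor_cyclic w : exists2 A, Gamma_q F A & A (vacuum F) = T w.
Proof.
pose P x := exists2 A, Gamma_q F A & A (vacuum F) = x.
have PD x y : P x -> P y -> P (x + y).
  move=> [A GA <-] [B GB <-]; exists (A + B) => //.
  exact: alg_add Gamma_unital _ _ GA GB.
have PZ a x : P x -> P (a *: x).
  move=> [A GA <-]; exists (a *: A) => //.
  exact: alg_scale Gamma_unital _ _ GA.
have P0 : P 0 by exists 0 => //; exact: unital0 Gamma_unital.
have PX f x : P x -> P (q_gaussian F f x).
  move=> [A GA <-]; exists (q_gaussian F f \o A) => //.
  exact: alg_comp Gamma_unital _ _ (Gamma_gaussian f) GA.
rewrite -/(P _).
(* The induction is on a bound for the length, since [annihilate F f w] involves words obtained from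
   [w] by deletions, which structural induction does not reach. *)
have [n] := ubnP (size w); elim: n w => // n IH [_|u w /= sw].
  by exists idfun => //; exact: alg_id Gamma_unital.
have Pf f : P (T (of_real f :: w)).
  rewrite -[T _](addrK (annihilate F f w)) -q_gaussianE // -scaleN1r.
  apply: (PD); first by apply: PX; exact: IH.
  apply: (PZ); rewrite annihilateE; apply: big_ind => // i _.
  apply: (PZ); apply: IH; rewrite size_del_nth //.
  by rewrite ltnS in sw; exact: leq_ltn_trans (leq_pred _) sw.
(* Gaussians take real vectors only, so a complex head is split into its real and imaginary
   parts. *)
rewrite (complexificationE u) (tensor_consD hdot) (tensor_consZ hdot).
by apply: (PD) => //; exact: (PZ).
Qed.

Variable L : L2_Gamma F.

(** The Gram condition holds because [tau_q (adjoint B \o A)] is the inner product of [A Omega] and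
    [B Omega]. [L2_inner] speaks only of members of [Gamma_q F], hence the sigma type [I] as
    index. *)
Lemma at_vacuumP : isometric (at_vacuum (L := L)) /\
  forall A, Gamma_q F A -> at_vacuum (L2_class L A) = A (vacuum F).
Proof.
pose I := {A | Gamma_q F A}.
pose cl (A : I) := L2_class L (sval A).
have dcl : closure (range (lincomb cl)) = setT.
  rewrite -subTset -(L2_dense L); apply: closureS => _ [A GA <-].
  by exists [:: (1, exist _ A GA)] => //; rewrite lincomb1.
have [|U [iU UE]] := isometric_extension (T' := fun A : I => sval A (vacuum F)) dcl.
  move=> [A GA] [B GB]; rewrite /cl /= L2_inner // /tau_q /=.
  by rewrite inner_adjointl //; exact: Gamma_bounded.
have hU : [set U : L -> F | bounded_op U /\
    forall A, Gamma_q F A -> U (L2_class L A) = A (vacuum F)] U.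
  split; first exact: isometric_bounded.
  by move=> A GA; exact: (UE (exist _ A GA)).
have [bG GE] := getPex (ex_intro _ U hU).
(* [get] promises only boundedness; agreement with [U] on a dense set transfers the isometry. *)
suff UV : at_vacuum (L := L) = U by rewrite UV; split => // A GA; exact: hU.2.
apply: (eq_bounded_dense bG hU.1 (L2_dense L)) => _ [A GA <-].
by rewrite GE // hU.2.
Qed.

Lemma at_vacuum_isometric : isometric (at_vacuum (L := L)).
Proof. exact: at_vacuumP.1. Qed.

Lemma at_vacuum_class A : Gamma_q F A -> at_vacuum (L2_class L A) = A (vacuum F).
Proof. exact: at_vacuumP.2. Qed.

Lemma at_vacuum_surj (x : F) : exists a : L, at_vacuum a = x.
Proof.
suff : range (at_vacuum (L := L)) x by case=> a _ <-; exists a.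
apply: isometric_range_closed; first exact: at_vacuum_isometric.
suff -> : closure (range (at_vacuum (L := L))) = setT by [].
rewrite -subTset -(tensor_span_dense F); apply: closureS => _ [c _ <-].
have lU := at_vacuum_isometric.1.
elim: c => [|p c [a _ ac]].
  by exists 0; rewrite ?(linear_op0 lU) // /lincomb big_nil.
have [A GA AE] := tensor_cyclic p.2.
exists (p.1 *: L2_class L A + a) => //.
by rewrite lU ac at_vacuum_class // AE /lincomb big_cons.
Qed.

End Vacuum.
(** * Diagonal embedding and holomorphic algebra *)

Lemma dot_sum_symmetric_bilinear (R : realType) (H : lmodType R) (dot : H -> H -> R) :
  symmetric_bilinear dot -> symmetric_bilinear (dot_sum dot).
Proof.
move=> hdot; split=> [x y z|a x z|x y]; rewrite /dot_sum /=.
- by rewrite !(dotDl hdot) addrACA.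
- by rewrite !(dotZl hdot) mulrDr.
- by rewrite (dotC hdot x.1) (dotC hdot x.2).
Qed.

Lemma cdotZr (R : realType) (K : lmodType R) (dot : K -> K -> R) a
    (u w : complexification K) : symmetric_bilinear dot ->
  cdot dot u (a *: w) = Num.conj a * cdot dot u w.
Proof.
by move=> hdot; rewrite (cdotC hdot) (cdotZl hdot) rmorphM /= -(cdotC hdot).
Qed.

Section Diagonal.
Variables (R : realType) (H : lmodType R) (dot : H -> H -> R).
Hypothesis hdot : symmetric_bilinear dot.
Local Notation HC := (complexification H).
Implicit Types (u v : HC) (h : H).
Local Notation s2 := ((Num.sqrt (2 : R))^-1)%:C.
Local Notation hdot2 := (dot_sum_symmetric_bilinear hdot).

Lemma cpairD u v u' v' : cpair (u + v) (u' + v') =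
  cpair u u' + cpair v v' :> complexification (H * H)%type.
Proof. by []. Qed.

Lemma cpairZ a u v : cpair (a *: u) (a *: v) = a *: cpair u v.
Proof. by []. Qed.

Lemma diagD u v : diag (u + v) = diag u + diag v.
Proof. by rewrite /diag scalerDr cpairD scalerDr. Qed.

Lemma diagZ a u : diag (a *: u) = a *: diag u.
Proof. by rewrite /diag scalerA mulrC -scalerA cpairZ scalerA mulrC -scalerA. Qed.

Lemma diag_of_real h : diag (of_real h) = s2 *: (of_real (h, 0) + 'i *: of_real (0, h)).
Proof.
congr (_ *: _); apply: injective_projections; apply: injective_projections;
  by rewrite /= ?scale0r ?scale1r ?scaler0 /= ?subr0 ?addr0 ?add0r ?oppr0 ?addr0.
Qed.

Lemma s2_sqr : s2 * s2 = 2^-1.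
Proof.
rewrite -rmorphM /= -invfM -expr2 sqr_sqrtr // fmorphV /=.
by rewrite rmorph_nat.
Qed.

Lemma cdot_cpair u v u' v' :
  cdot (dot_sum dot) (cpair u v) (cpair u' v') = cdot dot u u' + cdot dot v v'.
Proof.
by apply/eqP; rewrite eq_complex /=; apply/andP; split; apply/eqP;
  rewrite /dot_sum /=; ring.
Qed.

Lemma cdot_diag u v : cdot (dot_sum dot) (diag u) (diag v) = cdot dot u v.
Proof.
rewrite /diag (cdotZl hdot2) (cdotZr _ _ _ hdot2) mulrA conj_real s2_sqr.
rewrite cdot_cpair (cdotZl hdot) (cdotZr _ _ _ hdot) mulrA.
have -> : 'i * Num.conj 'i = 1 :> R[i].
  rewrite -[Num.conj 'i]/('i^*) /=; apply/eqP; rewrite eq_complex /=.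
  by apply/andP; split; apply/eqP; ring.
by field.
Qed.

(** The conjugate-linear slot turns the sum into the pairing of a multiple of [(u, i u)] with
    [(h, - i h)], and [1 + i^2 = 0]. Up to a factor this is the coefficient with which [Z_q h] would
    remove the letter [diag u]. *)
Lemma cdot_diag_real u h :
  cdot (dot_sum dot) (diag u) (of_real (h, 0)) +
  'i * cdot (dot_sum dot) (diag u) (of_real (0, h)) = 0.
Proof.
have -> : of_real (h, 0) = cpair (of_real h) 0 by [].
have -> : of_real (0, h) = cpair 0 (of_real h) by [].
have c0 (w : HC) : cdot dot w 0 = 0.
  by rewrite -(scale0r 0) (cdotZr _ _ _ hdot) rmorph0 mul0r.
rewrite /diag !(cdotZl hdot2) !cdot_cpair !c0 addr0 add0r (cdotZl hdot).
have -> : s2 * cdot dot u (of_real h) + 'i * (s2 * ('i * cdot dot u (of_real h)))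
  = s2 * cdot dot u (of_real h) * (1 + 'i ^+ 2) by ring.
by rewrite sqr_i subrr mulr0.
Qed.

End Diagonal.

Section DiagonalFock.
Variables (R : realType) (q : R) (H : lmodType R) (dot : H -> H -> R).
Hypothesis hq : -1 <= q < 1.
Hypothesis hdot : symmetric_bilinear dot.
Variables (F : q_Fock q dot) (FF : q_Fock q (dot_sum dot)).
Local Notation HC := (complexification H).
Local Notation D := (diag_q FF F).
Local Notation hol := (@hol_alg R q H dot FF).
Local Notation hdot2 := (dot_sum_symmetric_bilinear hdot).
Local Notation s2 := ((Num.sqrt (2 : R))^-1)%:C.
Implicit Types (w t : seq HC) (h : H).

Lemma q_form_diag w t :
  q_form q (dot_sum dot) (map (@diag R H) w) (map (@diag R H) t) = q_form q dot w t.
Proof.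
elim: w t => [|u w IH] t.
  case: t => [|v t]; first by rewrite !q_form_nil.
  by rewrite !q_form_size.
rewrite /= !q_form_cons size_map; apply: eq_bigr => i _.
by rewrite (nth_map 0) // (cdot_diag hdot) -map_del_nth IH.
Qed.

Lemma diag_qP : isometric D /\
  forall w, D (tensor F w) = tensor FF (map (@diag R H) w).
Proof.
have [|E [iE ET]] := isometric_extension
    (T' := fun w => tensor FF (map (@diag R H) w)) (tensor_span_dense F).
  by move=> w t; rewrite !tensor_inner q_form_diag.
have hE : [set D : F -> FF | [/\ isometric D, D (vacuum F) = vacuum FF &
    forall w, D (tensor F w) = tensor FF (map (@diag R H) w)]] E.
  by split => //; exact: ET.
by have [iG _ GE] := getPex (ex_intro _ E hE).
Qed.

Lemma diag_q_isometric : isometric D.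
Proof. exact: diag_qP.1. Qed.

Lemma diag_q_tensor w : D (tensor F w) = tensor FF (map (@diag R H) w).
Proof. exact: diag_qP.2. Qed.

Lemma Z_q_bounded h : bounded_op (Z_q FF h).
Proof.
have bX f : bounded_op (q_gaussian FF f) by exact: (q_gaussian_bounded hq hdot2).
by apply: bounded_opZ; apply: bounded_opD => //; exact: bounded_opZ.
Qed.

(* The annihilation parts of [Z_q h] cancel on the range of the diagonal
   embedding, where it acts as a creation operator. *)
Lemma Z_q_tensor h w : Z_q FF h (tensor FF (map (@diag R H) w)) =
  tensor FF (map (@diag R H) (of_real h :: w)).
Proof.
rewrite /= diag_of_real (tensor_consZ hdot2) (tensor_consD hdot2) (tensor_consZ hdot2).
set W := map _ w.
rewrite -[LHS]/(s2 *: (q_gaussian FF (h, 0) (tensor FF W) +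
  'i *: q_gaussian FF (0, h) (tensor FF W))).
rewrite !(q_gaussianE hq hdot2); congr (_ *: _).
rewrite scalerDr addrACA -[RHS]addr0; congr (_ + _).
rewrite !annihilateE scaler_sumr -big_split big1 //= => i _.
have iw : (i < size w)%N by rewrite -(size_map (@diag R H)).
by rewrite scalerA -scalerDl (nth_map 0) // mulrCA -mulrDr
  (cdot_diag_real hdot) mulr0 scale0r.
Qed.

Lemma Z_q_diag h x : Z_q FF h (D x) = D (creation F h x).
Proof.
have bD := isometric_bounded diag_q_isometric.
suff /(congr1 (@^~ x)) : Z_q FF h \o D = D \o creation F h by [].
have bc := creation_bounded hq hdot F h.
apply: (eq_bounded_tensor (bounded_op_comp (Z_q_bounded h) bD)
  (bounded_op_comp bD bc)).
by move=> w /=; rewrite diag_q_tensor Z_q_tensor (creationE hq hdot) diag_q_tensor.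
Qed.

Lemma hol_Gamma : hol `<=` Gamma_q FF.
Proof.
move=> A; apply; first exact: von_neumann_banach (Gamma_von_neumann hq hdot2 FF).
move=> _ [h _ <-]; have uG := Gamma_unital hq hdot2 FF.
apply: (alg_scale uG); apply: (alg_add uG); first exact: Gamma_gaussian.
by apply: (alg_scale uG); exact: Gamma_gaussian.
Qed.

Lemma hol_Z h : hol (Z_q FF h).
Proof. by move=> M _; apply; exists h. Qed.

Lemma hol_unital : unital_algebra (hol).
Proof.
split.
- by move=> A /hol_Gamma; exact: (Gamma_bounded hq hdot2).
- by move=> M bM _; exact: alg_id (banach_alg bM).
- by move=> A B hA hB M bM SM; apply: (alg_add (banach_alg bM)); [exact: hA|exact: hB].
- by move=> a A hA M bM SM; apply: (alg_scale (banach_alg bM)); exact: hA.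
- by move=> A B hA hB M bM SM; apply: (alg_comp (banach_alg bM)); [exact: hA|exact: hB].
Qed.

Lemma diag_q_vacuum : D (vacuum F) = vacuum FF.
Proof. exact: diag_q_tensor. Qed.

Lemma hol_range A : hol A -> range D (A (vacuum FF)).
Proof.
move=> hA; have iD := diag_q_isometric.
have Dl a x y : range D x -> range D y -> range D (a *: x + y).
  by move=> [u _ <-] [v _ <-]; exists (a *: u + v); rewrite ?iD.1.
have bM := invariant_banach Dl (isometric_range_closed iD).
have [_ ] : [set A | bounded_op A /\ forall x, range D x -> range D (A x)] A.
  apply: hA => // _ [h _ <-]; split; first exact: Z_q_bounded.
  by move=> _ [x _ <-]; rewrite Z_q_diag; exists (creation F h x).
by apply; exists (vacuum F) => //; exact: diag_q_vacuum.
Qed.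

(** On diagonal words [Z_q] adds a letter and produces no shorter words, so plain induction on the
    word works, unlike in [tensor_cyclic]. *)
Lemma hol_cyclic c : exists2 A, hol A & A (vacuum FF) = D (lincomb (tensor F) c).
Proof.
pose P x := exists2 A, hol A & A (vacuum FF) = x.
have PD x y : P x -> P y -> P (x + y).
  move=> [A GA <-] [B GB <-]; exists (A + B) => //.
  exact: alg_add hol_unital _ _ GA GB.
have PZ a x : P x -> P (a *: x).
  move=> [A GA <-]; exists (a *: A) => //.
  exact: alg_scale hol_unital _ _ GA.
have PT w : P (tensor FF (map (@diag R H) w)).
  elim: w => [|u w IH] /=.
    by exists idfun => //; exact: alg_id hol_unital.
  have Ph h : P (tensor FF (map (@diag R H) (of_real h :: w))).
    rewrite -Z_q_tensor; case: IH => A GA AE.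
    exists (Z_q FF h \o A); last by rewrite /= AE.
    exact: alg_comp hol_unital _ _ (hol_Z h) GA.
  rewrite (complexificationE u) diagD diagZ (tensor_consD hdot2).
  rewrite (tensor_consZ hdot2 FF 'i).
  by apply: (PD); [exact: Ph|apply: (PZ); exact: Ph].
rewrite (lincomb_linear _ _ diag_q_isometric.1) -/(P _).
elim: c => [|p c IH].
  by rewrite /lincomb big_nil; exists 0 => //; exact: unital0 hol_unital.
rewrite /lincomb big_cons; apply: (PD) => //; apply: (PZ).
by rewrite /= diag_q_tensor.
Qed.

End DiagonalFock.
(** * Number operator *)

Section NumberOperator.
Variables (R : realType) (q : R) (K : lmodType R) (dot : K -> K -> R).
Variable F : q_Fock q dot.
Local Notation KC := (complexification K).
Local Notation T := (tensor F).
Implicit Types (w t : seq KC) (c d : seq (R[i] * seq KC)) (x y : F).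

Lemma tensor_ortho w t : size w != size t -> inner F (T w) (T t) = 0.
Proof. by move=> wt; rewrite tensor_inner q_form_size. Qed.

Let component n c := [seq p <- c | size p.2 == n].

Let component_ortho n m c d : n != m ->
  inner F (lincomb T (component n c)) (lincomb T (component m d)) = 0.
Proof.
move=> nm; rewrite /lincomb !big_filter inner_suml big1 // => p /eqP pn.
rewrite inner_sumr big1 // => r /eqP rm.
by rewrite innerZl innerZr tensor_ortho ?mulr0 // pn rm.
Qed.

Let lincomb_components (phi : nat -> R[i]) N c :
  all (fun p => (size p.2 < N)%N) c ->
  lincomb (fun w => phi (size w) *: T w) c =
  \sum_(n < N) phi n *: lincomb T (component n c).
Proof.
elim: c => [|p c IH] /=.
  by rewrite /lincomb big_nil big1 // => n _; rewrite big_nil scaler0.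
case/andP=> pN /IH; rewrite /lincomb big_cons => ->.
rewrite (bigD1 (Ordinal pN)) //= [RHS](bigD1 (Ordinal pN)) //= eqxx big_cons.
rewrite scalerDr !scalerA mulrC -addrA; congr (_ + (_ + _)).
apply: eq_bigr => n np; case: eqP => // e; case/negP: np.
by apply/eqP/val_inj; rewrite /= e.
Qed.

Let sqr_norm_components (phi : nat -> R[i]) N c :
  `|\sum_(n < N) phi n *: lincomb T (component n c)| ^+ 2 =
  \sum_(n < N) `|phi n| ^+ 2 * `|lincomb T (component n c)| ^+ 2.
Proof.
rewrite -innerE inner_suml; apply: eq_bigr => n _.
rewrite inner_sumr (bigD1 n) //= big1 => [|m mn].
  by rewrite innerZl innerZr innerE addr0 mulrA -normCK.
by rewrite innerZl innerZr component_ortho ?mulr0 // eq_sym.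
Qed.

(** Words of different lengths are orthogonal, so the squared norm splits over lengths and each part
    is scaled by at most 1. *)
Lemma degree_multiplier_contraction (phi : nat -> R[i]) c :
  (forall n, `|phi n| <= 1) ->
  `|lincomb (fun w => phi (size w) *: T w) c| <= 1 * `|lincomb T c|.
Proof.
move=> phi1; have [N cN] : exists N, all (fun p => (size p.2 < N)%N) c.
  exists (\sum_(p <- c) size p.2).+1; apply/allP => p pc.
  by rewrite ltnS (big_rem p) //= leq_addr.
have -> : lincomb T c = lincomb (fun w => (1 : R[i]) *: T w) c.
  by congr (lincomb _ c); apply/funext => w; rewrite scale1r.
rewrite mul1r (lincomb_components _ cN) (lincomb_components (fun=> 1) cN).
rewrite -(@ler_pXn2r _ 2%N) ?nnegrE // sqr_norm_components.
rewrite (sqr_norm_components (fun=> 1)).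
apply: ler_sum => n _; rewrite normr1 expr1n ler_wpM2r ?exprn_ge0 //.
by rewrite exprn_ile1.
Qed.

Lemma number_resolvent : exists B : F -> F,
  [/\ bounded_op B, forall w, B (T w) = (size w).+1%:R^-1 *: T w &
      forall x y, inner F (B x) y = inner F x (B y)].
Proof.
have h c : `|lincomb (fun w => ((size w).+1%:R^-1 : R[i]) *: T w) c| <=
    1 * `|lincomb T c|.
  apply: (@degree_multiplier_contraction (fun n => n.+1%:R^-1)) => n.
  by rewrite ger0_norm ?invr_ge0 // invf_le1 ?ltr0n // ler1n.
have [B [lB bB BT]] := bounded_extension (tensor_span_dense F) h.
have bdB : bounded_op B by split => //; exists 1.
exists B; split => //; suff BE : adjoint B = B.
  by move=> x y; rewrite -[in RHS]BE inner_adjointr.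
apply: (eq_bounded_tensor (adjoint_bounded bdB) bdB) => w.
apply: fock_inj => t; rewrite inner_adjointl // !BT innerZr innerZl.
have -> : Num.conj ((size t).+1%:R^-1 : R[i]) = (size t).+1%:R^-1.
  by rewrite fmorphV /= rmorph_nat.
by have [->//|wt] := eqVneq (size w) (size t); rewrite tensor_ortho ?mulr0.
Qed.

(* The adjoint of the number operator on the span of the elementary tensors. It
   is symmetric, hence the unique self-adjoint extension, because it is the graph
   of [B^-1 - 1] for the bounded self-adjoint resolvent [B = (1 + N)^-1]. *)
Definition number_graph : set (F * F) :=
  [set p | forall w, inner F p.2 (T w) = (size w)%:R * inner F p.1 (T w)].

Lemma number_graph_tensor w : number_graph (T w, (size w)%:R *: T w).
Proof.
move=> t /=; rewrite innerZl.
by have [->//|wt] := eqVneq (size w) (size t); rewrite tensor_ortho ?mulr0.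
Qed.

(** [y = N x] means [(1 + N) x = x + y], so membership in an unbounded graph becomes an equation for
    the bounded [B]. *)
Lemma number_graph_resolvent (B : F -> F) x y : bounded_op B ->
  (forall w, B (T w) = (size w).+1%:R^-1 *: T w) ->
  (forall x y, inner F (B x) y = inner F x (B y)) ->
  number_graph (x, y) <-> x = B (x + y).
Proof.
move=> bB BT Bs.
have BE w : inner F (B (x + y)) (T w) =
    (size w).+1%:R^-1 * (inner F x (T w) + inner F y (T w)).
  rewrite Bs BT innerZr innerDl; congr (_ * _).
  by rewrite fmorphV /= rmorph_nat.
have nz w : (size w).+1%:R != 0 :> R[i] by rewrite pnatr_eq0.
split=> [h|h w /=].
  apply: fock_inj => w; rewrite BE h /= -{2}[inner F x _]mul1r -mulrDl.
  by rewrite -natr1 addrC mulrA mulVf ?mul1r // natr1.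
have := BE w; rewrite -h => /(congr1 ( *%R (size w).+1%:R)).
rewrite mulrA mulfV // mul1r -natr1 mulrDl mul1r addrC.
by move/addrI => <-.
Qed.

Lemma number_graph_symmetric x y u v :
  number_graph (x, y) -> number_graph (u, v) -> inner F v x = inner F u y.
Proof.
have [B [bB BT Bs]] := number_resolvent.
move=> /(number_graph_resolvent _ _ bB BT Bs) hx.
move=> /(number_graph_resolvent _ _ bB BT Bs) hu.
(* Move [B] across in [<u + v, B (x + y)>]; then [<u, x>] cancels from both sides. *)
have : inner F (u + v) x = inner F u (x + y) by rewrite {1}hx -Bs -hu.
by rewrite innerDl innerDr => /addrI.
Qed.

Lemma number_graph_self_adjoint : self_adjoint_graph number_graph.
Proof.
split=> [|x y].
  rewrite -subTset -(tensor_span_dense F); apply: closureS => _ [c _ <-].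
  exists (lincomb T c, lincomb (fun w => (size w)%:R *: T w) c) => // t /=.
  rewrite /lincomb !inner_suml mulr_sumr; apply: eq_bigr => p _.
  rewrite [LHS]innerZl [in RHS]innerZl.
  by have /= -> := number_graph_tensor p.2 t; rewrite mulrCA.
split=> [h u v huv|h w /=]; first exact: number_graph_symmetric.
have := h _ _ (number_graph_tensor w); rewrite innerZl => hw.
by rewrite innerC -hw rmorphM /= rmorph_nat -innerC.
Qed.

(** Self-adjoint graphs are maximal symmetric. Testing against the tensors puts the graph chosen by
    [get] inside [number_graph]; symmetry of the latter puts it inside the adjoint of the chosen
    graph, which is that graph itself. *)
Lemma number_opE : number_op F = number_graph.
Proof.
have hG : [set G | self_adjoint_graph G /\
    forall w, G (T w, (size w)%:R *: T w)] number_graph.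
  by split; [exact: number_graph_self_adjoint|exact: number_graph_tensor].
have [[_ sG] GT] := getPex (ex_intro _ _ hG).
have sub : number_op F `<=` number_graph.
  move=> [x y] /sG h w /=; have := h _ _ (GT w); rewrite innerZl => hw.
  by rewrite innerC -hw rmorphM /= rmorph_nat -innerC.
apply/seteqP; split => // -[x y] hxy; apply/sG => u v /sub huv.
exact: number_graph_symmetric.
Qed.

End NumberOperator.

Section NumberDiagonal.
Variables (R : realType) (q : R) (H : lmodType R) (dot : H -> H -> R).
Hypothesis hdot : symmetric_bilinear dot.
Variables (F : q_Fock q dot) (FF : q_Fock q (dot_sum dot)).
Local Notation D := (diag_q FF F).

Lemma number_diag x y : number_op F (x, y) -> number_op FF (D x, D y).
Proof.
rewrite !number_opE.
have [B [bB BT Bs]] := number_resolvent F.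
have [C [bC CT Cs]] := number_resolvent FF.
move=> /(number_graph_resolvent _ _ bB BT Bs) hx.
apply/(number_graph_resolvent _ _ bC CT Cs).
have iD := diag_q_isometric hdot F FF; have bD := isometric_bounded iD.
rewrite -(linear_opD _ _ iD.1) [in LHS]hx.
suff /(congr1 (@^~ (x + y))) : D \o B = C \o D by [].
apply: (eq_bounded_tensor (bounded_op_comp bD bB) (bounded_op_comp bC bD)) => w /=.
by rewrite BT (linear_opZ _ _ iD.1) (diag_q_tensor hdot) CT size_map.
Qed.

Lemma number_diag_inv x z : number_op FF (D x, z) ->
  exists2 y, number_op F (x, y) & z = D y.
Proof.
have iD := diag_q_isometric hdot F FF.
have [E [bE DE]] := adjoint_exists (isometric_bounded iD).
(* The candidate is the adjoint applied to [z]: pairing it with [T w] is pairing [z] with [D (T w)],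
   a word of the same length. *)
move=> hz; have hy : number_op F (x, E z).
  rewrite number_opE => w /=; rewrite innerC -DE -innerC (diag_q_tensor hdot).
  move: hz; rewrite number_opE => -> /=.
  by rewrite size_map -(diag_q_tensor hdot F) iD.2.
(* Both [z] and [D (E z)] are values of the number operator at [D x], which is single-valued. *)
exists (E z) => //; apply: fock_inj => t.
move: hz (number_diag hy); rewrite number_opE => hz hD.
by rewrite hz hD.
Qed.

End NumberDiagonal.
(** * Hermite polynomials *)

Section Horner.
Variables (R : realType) (F : complexHilbert R) (A : F -> F).
Hypothesis lA : linear A.
Implicit Types (p r : {poly R}) (v : F).

(** Padding with zero coefficients gives sums of equal length for polynomials of different sizes. *)
Lemma op_horner_wide m p v : (size p <= m)%N ->
  op_horner p A v = \sum_(i < m) (p`_i)%:C *: iter i A v.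
Proof.
move=> pm; rewrite /op_horner fct_sumE.
rewrite (big_ord_widen _ (fun i => (p`_i)%:C *: iter i A v) pm).
rewrite big_mkcond /=; apply: eq_bigr => i _.
by case: ltnP => // pi; rewrite nth_default // scale0r.
Qed.

Lemma op_horner1 v : op_horner 1 A v = v.
Proof. by rewrite (@op_horner_wide 1) ?size_poly1 // big_ord1 coef1 scale1r. Qed.

Lemma op_hornerB p r v : op_horner (p - r) A v = op_horner p A v - op_horner r A v.
Proof.
pose m := maxn (size p) (size r).
have pm : (size p <= m)%N by exact: leq_maxl.
have rm : (size r <= m)%N by exact: leq_maxr.
have prm : (size (p - r)%R <= m)%N.
  by apply: leq_trans (size_polyD _ _) _; rewrite size_polyN.
rewrite (op_horner_wide _ pm) (op_horner_wide _ rm) (op_horner_wide _ prm) -sumrB.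
by apply: eq_bigr => i _; rewrite coefB rmorphB /= scalerBl.
Qed.

Lemma op_hornerCM a p v : op_horner (a%:P * p) A v = a%:C *: op_horner p A v.
Proof.
have pm : (size (a%:P * p)%R <= size p)%N by rewrite mul_polyC size_scale_leq.
rewrite (op_horner_wide _ pm) (op_horner_wide _ (leqnn _)) scaler_sumr.
by apply: eq_bigr => i _; rewrite coefCM rmorphM /= scalerA.
Qed.

Lemma op_hornerXM p v : op_horner ('X * p) A v = A (op_horner p A v).
Proof.
have pm : (size ('X * p)%R <= (size p).+1)%N.
  by apply: leq_trans (size_polyMleq _ _) _; rewrite size_polyX.
rewrite (op_horner_wide _ pm) (op_horner_wide _ (leqnn _)).
rewrite big_ord_recl coefXM /= scale0r add0r.
pose A' : {linear F -> F} := HB.pack A (GRing.isLinear.Build _ _ _ _ A lA).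
transitivity (A' (\sum_(i < size p) (p`_i)%:C *: iter i A v)); last by [].
rewrite linear_sum; apply: eq_bigr => i _.
by rewrite coefXM linearZ.
Qed.

Lemma op_horner_hermite q n v : op_horner (q_hermite q n.+2) A v =
  A (op_horner (q_hermite q n.+1) A v) -
  ((q ^+ n.+1 - 1) / (q - 1))%:C *: op_horner (q_hermite q n) A v.
Proof. by rewrite op_hornerB op_hornerXM op_hornerCM. Qed.

End Horner.

Section HermiteWords.
Variables (R : realType) (q : R) (K : lmodType R) (dot : K -> K -> R).
Hypothesis hq : -1 <= q < 1.
Hypothesis hdot : symmetric_bilinear dot.
Variable F : q_Fock q dot.
Local Notation KC := (complexification K).
Local Notation T := (tensor F).
Implicit Types (w t : seq KC) (f : K).

Lemma annihilate_cons_same f w : annihilate F f (of_real f :: w) =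
  (dot f f)%:C *: T w + q%:C *: creation F f (annihilate F f w).
Proof.
rewrite annihilate_cons (cdot_real hdot); congr (_ + _ *: _).
rewrite /annihilate (lincomb_linear _ _ (creation_bounded hq hdot F f).1).
by congr (lincomb _ _); apply/funext => t /=; rewrite creationE.
Qed.

(** The factor is the q-integer [1 + q + ... + q^n]; passing one more copy of [f] gives the
    recursion [[n+2] = 1 + q * [n+1]]. *)
Lemma annihilate_nseq f n w : dot f f = 1 -> annihilate F f w = 0 ->
  annihilate F f (nseq n.+1 (of_real f) ++ w) =
  ((q ^+ n.+1 - 1) / (q - 1))%:C *: T (nseq n (of_real f) ++ w).
Proof.
move=> ff fw; have lc := (creation_bounded hq hdot F f).1.
have q1 : q - 1 != 0 by rewrite subr_eq0 lt_eqF //; case/andP: hq.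
elim: n => [|n IH] /=.
  rewrite annihilate_cons_same ff fw (linear_op0 lc) scaler0 addr0.
  by rewrite expr1 divff.
rewrite annihilate_cons_same IH ff (linear_opZ _ _ lc) creationE //= scalerA -scalerDl.
by congr (_ *: _); rewrite -rmorphM -rmorphD /=; congr (_%:C); rewrite !exprS; field.
Qed.

(** The recursion of [q_hermite] has order two, so two consecutive degrees are carried along. Its
    subtracted term is exactly the contraction from [annihilate_nseq], which leaves pure
    creation. *)
Lemma hermite_tensor f n w : dot f f = 1 -> annihilate F f w = 0 ->
  op_horner (q_hermite q n) (q_gaussian F f) (T w) = T (nseq n (of_real f) ++ w).
Proof.
move=> ff fw; have lX := (q_gaussian_bounded hq hdot F f).1.
suff h :
    op_horner (q_hermite q n) (q_gaussian F f) (T w) =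
      T (nseq n (of_real f) ++ w) /\
    op_horner (q_hermite q n.+1) (q_gaussian F f) (T w) =
      T (nseq n.+1 (of_real f) ++ w).
  by case: h.
elim: n => [|n [IH0 IH1]]; last first.
  split=> //; rewrite op_horner_hermite // IH0 IH1 q_gaussianE //.
  by rewrite annihilate_nseq // addrK.
split; first by rewrite op_horner1.
have -> : q_hermite q 1 = 'X * 1 by rewrite mulr1.
by rewrite op_hornerXM // op_horner1 q_gaussianE // fw addr0.
Qed.

Lemma annihilate_ortho f w :
  (forall i, (i < size w)%N -> cdot dot (nth 0 w i) (of_real f) = 0) ->
  annihilate F f w = 0.
Proof.
by move=> h; rewrite annihilateE big1 // => i _; rewrite h // mulr0 scale0r.
Qed.

Lemma annihilate_ortho_head f u w : q = 0 -> cdot dot u (of_real f) = 0 ->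
  annihilate F f (u :: w) = 0.
Proof. move=> q0 uf; rewrite annihilate_cons uf.
have -> : q%:C = 0 by rewrite q0.
by rewrite !scale0r addr0. Qed.

Lemma op_prodS_iota k m (X : nat -> F -> F) x :
  (\big[(fun A B => A \o B)/idfun]_(l <- iota k m.+1) X l) x =
  X k ((\big[(fun A B => A \o B)/idfun]_(l <- iota k.+1 m) X l) x).
Proof. by rewrite /= big_cons. Qed.

Lemma op_prod_iota k (X : nat -> F -> F) :
  op_prod k X = \big[(fun A B => A \o B)/idfun]_(l <- iota 0 k) X l.
Proof. by rewrite /op_prod -(big_mkord xpredT X) /index_iota subn0. Qed.

End HermiteWords.

(** * Products of Hermite polynomials and of holomorphic powers *)

Definition power_word (R : realType) (K : lmodType R) (J : Type) (e : J -> K)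
    (j : nat -> J) (n : nat -> nat) (r : seq nat) : seq (complexification K) :=
  flatten [seq nseq (n l) (of_real (e (j l))) | l <- r].

Section HermiteProducts.
Variables (R : realType) (q : R) (K : lmodType R) (dot : K -> K -> R).
Hypothesis hq : -1 <= q < 1.
Hypothesis hdot : symmetric_bilinear dot.
Variable F : q_Fock q dot.
Variables (J : eqType) (e : J -> K) (k : nat) (j : nat -> J) (n : nat -> nat).
Hypothesis he : forall a b, dot (e a) (e b) = (a == b)%:R.
Hypothesis hn : forall l, (l < k)%N -> (0 < n l)%N.
Hypothesis hj : forall l, (l.+1 < k)%N -> j l != j l.+1.
Hypothesis hqj : q = 0 \/ forall l m, (l < m < k)%N -> j l != j m.

(** For general [q] every letter to the right may be contracted, so all of them must be orthogonal
    to [e (j l)]. For [q = 0] only the first one is, and a nonempty next block makes it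
    [e (j l.+1)]. *)
Lemma annihilate_power_word l m : (l + m.+1 = k)%N ->
  annihilate F (e (j l)) (power_word e j n (iota l.+1 m)) = 0.
Proof.
have ortho l' : j l != j l' -> cdot dot (of_real (e (j l'))) (of_real (e (j l))) = 0.
  by move=> h; rewrite (cdot_real hdot) he eq_sym (negbTE h).
move=> lmk; case: hqj => [q0|hd].
  case: m lmk => [|m] lmk; first by apply: annihilate_ortho.
  have lk : (l.+1 < k)%N by lia.
  rewrite /power_word /=; case: (n l.+1) (hn lk) => // p _ /=.
  by apply: annihilate_ortho_head => //; apply: ortho; exact: hj.
apply: annihilate_ortho => i iw; have := mem_nth 0 iw.
case/flattenP => s /mapP[l' /=]; rewrite mem_iota => ll' -> /nseqP[-> _].
by apply: ortho; apply: hd; lia.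
Qed.

Lemma hermite_prod :
  op_prod k (fun l => op_horner (q_hermite q (n l)) (q_gaussian F (e (j l))))
    (vacuum F) = tensor F (power_word e j n (iota 0 k)).
Proof.
rewrite op_prod_iota; have : (0 + k = k)%N by [].
(* The induction runs over the last [m] factors, starting at index [l] with [l + m = k], while the
   hypotheses keep the original [k]. *)
move: {1 3 4}k 0%N; elim=> [|m IH] l lmk; first by rewrite big_nil.
rewrite op_prodS_iota IH; last by rewrite addSnnS.
rewrite hermite_tensor // ?he ?eqxx //.
exact: annihilate_power_word.
Qed.

End HermiteProducts.

Section ZProducts.
Variables (R : realType) (q : R) (H : lmodType R) (dot : H -> H -> R).
Hypothesis hq : -1 <= q < 1.
Hypothesis hdot : symmetric_bilinear dot.
Variable FF : q_Fock q (dot_sum dot).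
Local Notation hdot2 := (dot_sum_symmetric_bilinear hdot).

Lemma Z_q_iter h n w : iter n (Z_q FF h) (tensor FF (map (@diag R H) w)) =
  tensor FF (map (@diag R H) (nseq n (of_real h) ++ w)).
Proof. by elim: n => //= n ->; rewrite (Z_q_tensor hq hdot). Qed.

Lemma Z_q_prod J (e : J -> H) k (j : nat -> J) (n : nat -> nat) :
  op_prod k (fun l => iter (n l) (Z_q FF (e (j l)))) (vacuum FF) =
  tensor FF (map (@diag R H) (power_word e j n (iota 0 k))).
Proof.
rewrite op_prod_iota; move: 0%N; elim: k => [|m IH] l; first by rewrite big_nil.
by rewrite op_prodS_iota IH Z_q_iter.
Qed.

End ZProducts.
(** * Segal-Bargmann transform *)

Lemma inner_symmetric_bilinear (R : realType) (H : realHilbert R) :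
  symmetric_bilinear (inner H).
Proof.
split=> [x y z|a x z|x y]; first exact: linearDl.
  exact: linearZl_LR.
by rewrite (hermC (inner H)) expr0 mul1r.
Qed.

Section SegalBargmann.
Variables (R : realType) (q : R) (H : lmodType R) (dot : H -> H -> R).
Hypothesis hq : -1 <= q < 1.
Hypothesis hdot : symmetric_bilinear dot.
Variables (F : q_Fock q dot) (FF : q_Fock q (dot_sum dot)).
Variables (L : L2_Gamma F) (LL : L2_Gamma FF).
Local Notation D := (diag_q FF F).
Local Notation U := (@at_vacuum _ _ _ _ F L).
Local Notation UU := (@at_vacuum _ _ _ _ FF LL).
Local Notation hdot2 := (dot_sum_symmetric_bilinear hdot).

Lemma segal_bargmann_exists : exists S : L -> LL,
  isometric S /\ forall a, UU (S a) = D (U a).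
Proof.
have iU := at_vacuum_isometric hq hdot L.
have iUU := at_vacuum_isometric hq hdot2 LL.
have iD := diag_q_isometric hdot F FF.
(* A preimage under [UU] is chosen pointwise; injectivity of [UU] makes it unique and therefore
   linear in [a]. *)
have /choice[S SE] : forall a : L, exists b : LL, UU b = D (U a).
  by move=> a; exact: (at_vacuum_surj hq hdot2).
exists S; split => //; split=> [a x y|x y].
  by apply: (isometric_inj iUU); rewrite iUU.1 !SE iU.1 iD.1.
by rewrite -iUU.2 !SE iD.2 iU.2.
Qed.

Variable S : L -> LL.
Hypothesis iS : isometric S.
Hypothesis SE : forall a, UU (S a) = D (U a).

Lemma at_vacuum_hol A : hol_alg A -> UU (L2_class LL A) = A (vacuum FF).
Proof. by move=> hA; apply: (at_vacuum_class hq hdot2); exact: (hol_Gamma hq hdot). Qed.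

Lemma segal_bargmann_range : range S = L2_hol LL.
Proof.
have iU := at_vacuum_isometric hq hdot L.
have iUU := at_vacuum_isometric hq hdot2 LL.
have iD := diag_q_isometric hdot F FF.
apply/seteqP; split=> [_ [a _ <-]|b /closureP hb].
  apply/closureP => e e0.
  have /denseP/(_ (U a) e e0)[_ [c _ <-] ac] := tensor_span_dense F.
  have [A hA AE] := hol_cyclic hq hdot F FF c.
  exists (L2_class LL A); first by exists A.
  rewrite -(isometricP iUU) (linear_opB _ _ iUU.1) SE at_vacuum_hol // AE.
  by rewrite -(linear_opB _ _ iD.1) (isometricP iD).
have : range D (UU b).
  apply: (isometric_range_closed iD); apply/closureP => e e0.
  have [_ [A hA <-] bA] := hb e e0; exists (A (vacuum FF)).
    exact: (hol_range hq hdot).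
  by rewrite -at_vacuum_hol // -(linear_opB _ _ iUU.1) (isometricP iUU).
case=> x _ xb; have [a ax] := at_vacuum_surj hq hdot L x.
by exists a => //; apply: (isometric_inj iUU); rewrite SE ax.
Qed.

Lemma segal_bargmann_hermite (J : eqType) (e : J -> H) (k : nat) (j : nat -> J)
    (n : nat -> nat) :
  (forall a b, dot (e a) (e b) = (a == b)%:R) ->
  (forall l, (l < k)%N -> (0 < n l)%N) ->
  (forall l, (l.+1 < k)%N -> j l != j l.+1) ->
  (q = 0 \/ forall l m, (l < m < k)%N -> j l != j m) ->
  S (L2_class L (op_prod k (fun l =>
       op_horner (q_hermite q (n l)) (q_gaussian F (e (j l))))))
  = L2_class LL (op_prod k (fun l => iter (n l) (Z_q FF (e (j l))))).
Proof.
move=> he hn hj hqj; have uG := Gamma_unital hq hdot F.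
apply: (isometric_inj (at_vacuum_isometric hq hdot2 LL)).
rewrite SE (at_vacuum_class hq hdot); last first.
  apply: (unital_prod uG) => l _; apply: (unital_horner _ uG).
  exact: Gamma_gaussian.
rewrite (hermite_prod hq hdot F he hn hj hqj) (diag_q_tensor hdot).
rewrite at_vacuum_hol ?(Z_q_prod hq hdot) //.
have uh := hol_unital hq hdot FF.
by apply: (unital_prod uh) => l _; apply: (unital_iter _ uh); exact: hol_Z.
Qed.

(** These are the graphs of [S N] and [N S], so their equality also matches the domains. The harder
    inclusion is [number_diag_inv]: [N] maps no vector of the range of [diag_q] out of that
    range. *)
Lemma segal_bargmann_number :
  [set p | exists2 b, number_L2 (p.1, b) & p.2 = S b]
  = [set p | number_hol LL (S p.1, p.2)].
Proof.
apply/seteqP; split=> -[a c] /=.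
  case=> b ab ->; split; first by rewrite /number_L2 /= !SE; exact: number_diag.
  by rewrite /= -segal_bargmann_range; exists a.
case; rewrite /number_L2 /= SE => /(number_diag_inv hdot)[y ay cy] _.
have [b bb] := at_vacuum_surj hq hdot L y.
exists b; first by rewrite bb.
apply: (isometric_inj (at_vacuum_isometric hq hdot2 LL)).
by rewrite SE bb.
Qed.

End SegalBargmann.

Theorem mainTheorem2 (R : realType) (H : realHilbert R) (q : R)
    (hq : -1 <= q < 1)
    (F : q_Fock q (inner H)) (FF : q_Fock q (dot_sum (inner H)))
    (L : L2_Gamma F) (LL : L2_Gamma FF) :
  exists S : L -> LL,
    [/\ unitary_onto S (L2_hol LL),
        forall a : L, at_vacuum (S a) = diag_q FF F (at_vacuum a),
        forall (J : eqType) (e : J -> H) (k : nat) (j : nat -> J)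
               (n : nat -> nat),
          (forall a b, inner H (e a) (e b) = (a == b)%:R) ->
          (forall l, (l < k)%N -> (0 < n l)%N) ->
          (forall l, (l.+1 < k)%N -> j l != j l.+1) ->
          (q = 0 \/ forall l m, (l < m < k)%N -> j l != j m) ->
          S (L2_class L (op_prod k (fun l =>
               op_horner (q_hermite q (n l)) (q_gaussian F (e (j l))))))
          = L2_class LL (op_prod k (fun l =>
               iter (n l) (Z_q FF (e (j l))))) &
        [set p | exists2 b, number_L2 (p.1, b) & p.2 = S b]
        = [set p | number_hol LL (S p.1, p.2)] ].
Proof.
have hdot := inner_symmetric_bilinear H.
have [S [iS SE]] := segal_bargmann_exists hq hdot L LL.
exists S; split => //.
- by split => //; exact: (segal_bargmann_range hq hdot SE).
- by move=> J e k j n; exact: (segal_bargmann_hermite hq hdot SE).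
- exact: (segal_bargmann_number hq hdot SE).
Qed.
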